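(* Let $R$ be a commutative noetherian ring. If $A$ and $B$ are Gorenstein $R$-algebras, then $A\otimes_R B$ is a Gorenstein $R$-algebra.
   Context: An associative ring is Iwanaga--Gorenstein if it is noetherian on both sides and has finite injective dimension over itself on both sides. An associative $R$-algebra $A$ is a Gorenstein $R$-algebra if it is finitely generated and projective as an $R$-module and $A_{\mathfrak p}$ is Iwanaga--Gorenstein for each $\mathfrak p\in\operatorname{Spec}R$ with $A_{\mathfrak p}\ne0$. *)

(* Defs.v *)
From HB Require Import structures.
From mathcomp Require Import all_boot all_algebra ring.
From mathcomp Require Import boolp.

Set Implicit Arguments.
Unset Strict Implicit.
Unset Printing Implicit Defensive.

Import GRing.Theory.
Local Open Scope ring_scope.
Local Open Scope quotient_scope.

(* Modules are left modules; right S-modules are left modules over S^c.       *)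
Section Modules.
Variable S : pzRingType.
Implicit Types M E P : lmodType S.

Definition submodule M (N : M -> Prop) : Prop :=
  N 0 /\ forall (a : S) (x y : M), N x -> N y -> N (a *: x + y).

Definition fg_submodule M (N : M -> Prop) : Prop :=
  exists (n : nat) (e : 'I_n -> M),
    forall x, N x <-> exists c : 'I_n -> S, x = \sum_(i < n) c i *: e i.

Definition finitely_generated M : Prop := fg_submodule (fun _ : M => True).

Definition noetherian_module M : Prop :=
  forall N : M -> Prop, submodule N -> fg_submodule N.

Definition projective_module P : Prop :=
  forall (X Y : lmodType S) (p : {linear X -> Y}) (g : {linear P -> Y}),
    (forall y, exists x, p x = y) ->
    exists h : {linear P -> X}, forall z, p (h z) = g z.

Definition injective_module E : Prop :=
  forall (X Y : lmodType S) (i : {linear X -> Y}) (g : {linear X -> E}),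
    injective i ->
    exists h : {linear Y -> E}, forall x, h (i x) = g x.

(* M has an injective resolution 0 -> M -> I^0 -> ... -> I^n -> 0, encoded as *)
(* an infinite exact sequence which vanishes beyond degree n.                 *)
Definition injdim_le M (n : nat) : Prop :=
  exists (I : nat -> lmodType S) (eps : {linear M -> I 0%N})
         (d : forall k, {linear I k -> I k.+1}),
    [/\ forall k, injective_module (I k),
        injective eps,
        forall x, d 0%N x = 0 <-> exists m, x = eps m,
        forall k x, d k.+1 x = 0 <-> exists y, x = d k y
      & forall k, (n < k)%N -> forall x : I k, x = 0].

Definition finite_injdim M : Prop := exists n, injdim_le M n.

End Modules.

Definition left_noetherian (S : pzRingType) : Prop :=
  noetherian_module (S^o : lmodType S).

Definition right_noetherian (S : pzRingType) : Prop := left_noetherian S^c.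

Definition iwanaga_gorenstein (S : pzRingType) : Prop :=
  [/\ left_noetherian S,
      right_noetherian S,
      finite_injdim (S^o : lmodType S)
    & finite_injdim ((S^c)^o : lmodType S^c)].

(* An associative unital R-algebra is a ring A with a ring morphism from R to *)
(* the center of A. The library's algType is not used because it excludes the *)
(* zero algebra, whereas a tensor product or a localization of nonzero        *)
(* algebras may be zero.                                                      *)
Record assocAlg (R : comPzRingType) := AssocAlg {
  alg_ring : pzRingType;
  alg_map : {rmorphism R -> alg_ring};
  alg_mapC : forall k x, alg_map k * x = x * alg_map k
}.

Definition alg_sort R (A : assocAlg R) : Type := alg_ring A.
Coercion alg_sort : assocAlg >-> Sortclass.

Section AlgebraInstances.
Variables (R : comPzRingType) (A : assocAlg R).

HB.instance Definition _ := GRing.PzRing.copy (alg_sort A) (alg_ring A).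

Definition alg_scale (k : R) (x : A) : A := alg_map A k * (x : alg_ring A).

Fact alg_scaleA k l x : alg_scale k (alg_scale l x) = alg_scale (k * l) x.
Proof. by rewrite /alg_scale rmorphM mulrA. Qed.
Fact alg_scale1 : left_id 1 alg_scale.
Proof. by move=> x; rewrite /alg_scale rmorph1 mul1r. Qed.
Fact alg_scaleDr : right_distributive alg_scale +%R.
Proof. by move=> k x y; rewrite /alg_scale mulrDr. Qed.
Fact alg_scaleDl x : {morph alg_scale^~ x : k l / k + l}.
Proof. by move=> k l; rewrite /alg_scale rmorphD mulrDl. Qed.

HB.instance Definition _ := GRing.Zmodule_isLmodule.Build R (alg_sort A)
  alg_scaleA alg_scale1 alg_scaleDr alg_scaleDl.

Lemma alg_scaleAl (k : R) (x y : A) : k *: (x * y) = (k *: x) * y.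
Proof. exact: mulrA. Qed.
Lemma alg_scaleAr (k : R) (x y : A) : k *: (x * y) = x * (k *: y).
Proof.
rewrite alg_scaleAl; transitivity ((x * alg_map A k : A) * y).
  by congr (_ * _); apply: alg_mapC.
by rewrite -[LHS]mulrA.
Qed.

Definition alg_pzRing : pzRingType := alg_sort A.
Definition alg_lmod : lmodType R := alg_sort A.

End AlgebraInstances.

Coercion alg_pzRing : assocAlg >-> GRing.PzRing.type.
Coercion alg_lmod : assocAlg >-> GRing.Lmodule.type.

Record spec (R : comPzRingType) := Spec {
  spec_pred :> {pred R};
  spec0 : 0 \in spec_pred;
  specD : forall x y, x \in spec_pred -> y \in spec_pred -> x + y \in spec_pred;
  specM : forall a x, x \in spec_pred -> a * x \in spec_pred;
  spec1 : 1 \notin spec_pred;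
  specP : forall x y, x * y \in spec_pred -> (x \in spec_pred) || (y \in spec_pred)
}.

(* Fractions a / s, with a in A and s in R outside p. Since A need not be a   *)
(* domain, equality of fractions is cross-multiplication up to a denominator. *)
Section Localization.
Variables (R : comPzRingType) (A : assocAlg R) (p : spec R).

Definition denom := {s : R | s \notin p}.
Definition dval (s : denom) : R := sval s.
Arguments dval : simpl never.

Fact denomM_subproof (s t : denom) : dval s * dval t \notin p.
Proof.
by apply/negP => /specP /orP[]; apply/negP; [exact: (svalP s)|exact: (svalP t)].
Qed.

Definition denom1 : denom := exist (fun s : R => s \notin p) 1 (spec1 p).
Definition denomM (s t : denom) : denom :=
  exist (fun s : R => s \notin p) (dval s * dval t) (denomM_subproof s t).

Lemma dval1 : dval denom1 = 1. Proof. by []. Qed.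
Lemma dvalM s t : dval (denomM s t) = dval s * dval t. Proof. by []. Qed.

Definition loc_rel (x y : A * denom) : bool :=
  `[< exists u : denom,
        dval u *: (dval y.2 *: x.1) = dval u *: (dval x.2 *: y.1) >].

Fact loc_rel_refl : reflexive loc_rel.
Proof. by move=> x; apply/asboolP; exists denom1. Qed.

Fact loc_rel_sym : symmetric loc_rel.
Proof. by move=> x y; apply/asboolP/asboolP => -[u uE]; exists u. Qed.

Fact loc_rel_trans : transitive loc_rel.
Proof.
move=> [b t] [a s] [c r] /asboolP[u /= uE] /asboolP[v /= vE]; apply/asboolP.
exists (denomM (denomM u v) t) => /=; move: uE vE; rewrite !(dvalM, scalerA) => uE vE.
transitivity ((dval v * dval r) *: ((dval u * dval t) *: a)).
  by rewrite scalerA; congr (_ *: _); ring.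
rewrite uE; transitivity ((dval u * dval s) *: ((dval v * dval r) *: b)).
  by rewrite !scalerA; congr (_ *: _); ring.
by rewrite vE scalerA; congr (_ *: _); ring.
Qed.

Canonical loc_equiv := EquivRel loc_rel loc_rel_refl loc_rel_sym loc_rel_trans.

Definition localization : Type := {eq_quot loc_equiv}.
HB.instance Definition _ := Choice.on localization.
HB.instance Definition _ := EqQuotient.on localization.

Definition frac (a : A) (s : denom) : localization := \pi_localization (a, s).

Lemma frac_eq a s b t :
  frac a s = frac b t <->
  exists u : denom, dval u *: (dval t *: a) = dval u *: (dval s *: b).
Proof.
by split=> [/eqmodP /asboolP //|h]; apply/eqmodP/asboolP.
Qed.

Definition num (x : localization) : A := (repr x).1.
Definition den (x : localization) : denom := (repr x).2.

Lemma frac_num_den x : frac (num x) (den x) = x.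
Proof. by rewrite /frac -surjective_pairing reprK. Qed.

Definition loc_add (x y : localization) : localization :=
  frac (dval (den y) *: num x + dval (den x) *: num y) (denomM (den x) (den y)).
Definition loc_opp (x : localization) : localization := frac (- num x) (den x).
Definition loc_mul (x y : localization) : localization :=
  frac (num x * num y) (denomM (den x) (den y)).

Lemma loc_addE a s b t :
  loc_add (frac a s) (frac b t) = frac (dval t *: a + dval s *: b) (denomM s t).
Proof.
have /frac_eq := frac_num_den (frac a s); have /frac_eq := frac_num_den (frac b t).
rewrite /loc_add.
move: (num (frac a s)) (den (frac a s)) (num (frac b t)) (den (frac b t)).
move=> a' s' b' t'.
move=> [v vE] [u uE]; apply/frac_eq; exists (denomM u v) => /=.
move: uE vE; rewrite !scalerDr !(dvalM, scalerA) => uE vE; congr (_ + _).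
  transitivity ((dval v * dval t' * dval t) *: ((dval u * dval s) *: a')).
    by rewrite scalerA; congr (_ *: _); ring.
  by rewrite uE !scalerA; congr (_ *: _); ring.
transitivity ((dval u * dval s' * dval s) *: ((dval v * dval t) *: b')).
  by rewrite scalerA; congr (_ *: _); ring.
by rewrite vE !scalerA; congr (_ *: _); ring.
Qed.

Lemma loc_oppE a s : loc_opp (frac a s) = frac (- a) s.
Proof.
have /frac_eq := frac_num_den (frac a s).
rewrite /loc_opp; move: (num _) (den _) => a' s' [u uE].
by apply/frac_eq; exists u; rewrite !scalerN uE.
Qed.

Lemma loc_mulE a s b t :
  loc_mul (frac a s) (frac b t) = frac (a * b) (denomM s t).
Proof.
have /frac_eq := frac_num_den (frac a s); have /frac_eq := frac_num_den (frac b t).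
rewrite /loc_mul.
move: (num (frac a s)) (den (frac a s)) (num (frac b t)) (den (frac b t)).
move=> a' s' b' t'.
move=> [v vE] [u uE]; apply/frac_eq; exists (denomM u v) => /=.
move: uE vE; rewrite !(dvalM, scalerA) => uE vE.
transitivity (((dval u * dval s) *: a') * ((dval v * dval t) *: b')).
  rewrite -alg_scaleAl -alg_scaleAr scalerA; congr (_ *: _); ring.
rewrite uE vE -alg_scaleAl -alg_scaleAr scalerA; congr (_ *: _); ring.
Qed.

Lemma loc_ind (P : localization -> Prop) :
  (forall a s, P (frac a s)) -> forall x, P x.
Proof. by move=> h x; rewrite -[x]frac_num_den. Qed.

Lemma eq_frac a s b t : dval t *: a = dval s *: b -> frac a s = frac b t.
Proof. by move=> h; apply/frac_eq; exists denom1; rewrite h. Qed.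

Fact loc_addA : associative loc_add.
Proof.
elim/loc_ind=> a s; elim/loc_ind=> b t; elim/loc_ind=> c r.
rewrite !loc_addE; apply: eq_frac => /=; rewrite !(dvalM, scalerDr, scalerA) addrA.
by congr (_ *: _ + _ *: _ + _ *: _); ring.
Qed.
Fact loc_addC : commutative loc_add.
Proof.
elim/loc_ind=> a s; elim/loc_ind=> b t.
rewrite !loc_addE; apply: eq_frac => /=; rewrite !(dvalM, scalerDr, scalerA) addrC.
by congr (_ *: _ + _ *: _); ring.
Qed.
Fact loc_add0 : left_id (frac 0 denom1) loc_add.
Proof.
elim/loc_ind=> a s; rewrite loc_addE; apply: eq_frac => /=.
by rewrite dvalM !dval1 scaler0 add0r scale1r mul1r.
Qed.
Fact loc_addN : left_inverse (frac 0 denom1) loc_opp loc_add.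
Proof.
elim/loc_ind=> a s; rewrite loc_oppE loc_addE; apply: eq_frac => /=.
by rewrite scalerN addNr !scaler0.
Qed.
Fact loc_mulA : associative loc_mul.
Proof.
elim/loc_ind=> a s; elim/loc_ind=> b t; elim/loc_ind=> c r.
by rewrite !loc_mulE; apply: eq_frac => /=; rewrite !(dvalM, mulrA).
Qed.
Fact loc_mul1l : left_id (frac 1 denom1) loc_mul.
Proof.
by elim/loc_ind=> a s; rewrite loc_mulE; apply: eq_frac => /=; rewrite ?(dvalM, dval1, mul1r).
Qed.
Fact loc_mul1r : right_id (frac 1 denom1) loc_mul.
Proof.
by elim/loc_ind=> a s; rewrite loc_mulE; apply: eq_frac => /=; rewrite ?(dvalM, dval1, mulr1).
Qed.
Fact loc_mulDl : left_distributive loc_mul loc_add.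
Proof.
elim/loc_ind=> a s; elim/loc_ind=> b t; elim/loc_ind=> c r.
rewrite !(loc_mulE, loc_addE); apply: eq_frac => /=.
rewrite mulrDl -!alg_scaleAl !(dvalM, scalerDr, scalerA).
by congr (_ *: _ + _ *: _); ring.
Qed.
Fact loc_mulDr : right_distributive loc_mul loc_add.
Proof.
elim/loc_ind=> a s; elim/loc_ind=> b t; elim/loc_ind=> c r.
rewrite !(loc_mulE, loc_addE); apply: eq_frac => /=.
rewrite mulrDr -!alg_scaleAr !(dvalM, scalerDr, scalerA).
by congr (_ *: _ + _ *: _); ring.
Qed.

HB.instance Definition _ := GRing.isPzRing.Build localization
  loc_addA loc_addC loc_add0 loc_addN
  loc_mulA loc_mul1l loc_mul1r loc_mulDl loc_mulDr.

End Localization.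

Definition gorenstein_algebra (R : comPzRingType) (A : assocAlg R) : Prop :=
  [/\ finitely_generated A,
      projective_module A
    & forall p : spec R, (exists x : localization A p, x <> 0) ->
        iwanaga_gorenstein (localization A p)].

(* Formal sums of pairs (x, y), modulo the congruence generated by            *)
(* commutativity and the balancing relations; tens_zero is needed because no  *)
(* other relation identifies a nonempty sum with the empty one. The universal *)
(* property is tens_universal.                                                *)
Section Tensor.
Variables (R : comPzRingType) (M N : lmodType R).
Implicit Types s t : seq (M * N).

Inductive tens_cong : seq (M * N) -> seq (M * N) -> Prop :=
| tens_refl s : tens_cong s s
| tens_sym s t : tens_cong s t -> tens_cong t s
| tens_trans s t u : tens_cong s t -> tens_cong t u -> tens_cong s u
| tens_cat s s' t t' :
    tens_cong s s' -> tens_cong t t' -> tens_cong (s ++ t) (s' ++ t')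
| tens_catC s t : tens_cong (s ++ t) (t ++ s)
| tens_zero y : tens_cong [:: (0, y)] [::]
| tens_addl x x' y : tens_cong [:: (x + x', y)] [:: (x, y); (x', y)]
| tens_addr x y y' : tens_cong [:: (x, y + y')] [:: (x, y); (x, y')]
| tens_scale k x y : tens_cong [:: (k *: x, y)] [:: (x, k *: y)].

Definition tens_rel s t : bool := `[< tens_cong s t >].

Fact tens_rel_refl : reflexive tens_rel.
Proof. by move=> s; apply/asboolP/tens_refl. Qed.
Fact tens_rel_sym : symmetric tens_rel.
Proof. by move=> s t; apply/asboolP/asboolP; apply: tens_sym. Qed.
Fact tens_rel_trans : transitive tens_rel.
Proof.
by move=> t s u /asboolP st /asboolP tu; apply/asboolP/(tens_trans st tu).
Qed.

Canonical tens_equiv :=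
  EquivRel tens_rel tens_rel_refl tens_rel_sym tens_rel_trans.

Definition tensor : Type := {eq_quot tens_equiv}.
HB.instance Definition _ := Choice.on tensor.
HB.instance Definition _ := EqQuotient.on tensor.

Definition tens_class s : tensor := \pi_tensor s.

Lemma tens_classP s t : tens_class s = tens_class t <-> tens_cong s t.
Proof. by split=> [/eqmodP /asboolP //|h]; apply/eqmodP/asboolP. Qed.

Lemma repr_tens s : tens_cong (repr (tens_class s)) s.
Proof. by apply/tens_classP; rewrite /tens_class reprK. Qed.

Lemma tens_classK x : tens_class (repr x) = x.
Proof. exact: reprK. Qed.

Definition tens_add (x y : tensor) : tensor := tens_class (repr x ++ repr y).
Definition tens_opp (x : tensor) : tensor :=
  tens_class [seq (- z.1, z.2) | z <- repr x].
Definition tens_scaling (k : R) (x : tensor) : tensor :=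
  tens_class [seq (k *: z.1, z.2) | z <- repr x].

Lemma tens_cong_map (f : M -> M) s t :
    f 0 = 0 -> {morph f : x x' / x + x'} -> (forall k, {morph f : x / k *: x}) ->
  tens_cong s t ->
  tens_cong [seq (f z.1, z.2) | z <- s] [seq (f z.1, z.2) | z <- t].
Proof.
move=> f0 fD fZ; elim=> {s t} /=.
- by move=> s; apply: tens_refl.
- by move=> s t _; apply: tens_sym.
- by move=> s t u _ st _; apply: tens_trans.
- by move=> s s' t t' _ ss' _ tt'; rewrite !map_cat; apply: tens_cat.
- by move=> s t; rewrite !map_cat; apply: tens_catC.
- by move=> y; rewrite f0; apply: tens_zero.
- by move=> x x' y; rewrite fD; apply: tens_addl.
- by move=> x y y'; apply: tens_addr.
- by move=> k x y; rewrite fZ; apply: tens_scale.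
Qed.

Lemma tens_addE s t : tens_add (tens_class s) (tens_class t) = tens_class (s ++ t).
Proof. by apply/tens_classP/tens_cat; apply: repr_tens. Qed.

Lemma tens_oppE s :
  tens_opp (tens_class s) = tens_class [seq (- z.1, z.2) | z <- s].
Proof.
apply/tens_classP/(@tens_cong_map -%R); last exact: repr_tens.
- exact: oppr0.
- exact: opprD.
- by move=> k x; rewrite scalerN.
Qed.

Lemma tens_scalingE k s :
  tens_scaling k (tens_class s) = tens_class [seq (k *: z.1, z.2) | z <- s].
Proof.
apply/tens_classP/(@tens_cong_map ( *:%R k)); last exact: repr_tens.
- exact: scaler0.
- exact: scalerDr.
- by move=> l x; rewrite !scalerA mulrC.
Qed.

Fact tens_addA : associative tens_add.
Proof.
move=> x y z; rewrite -[x]tens_classK -[y]tens_classK -[z]tens_classK.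
by rewrite !tens_addE catA.
Qed.
Fact tens_addC : commutative tens_add.
Proof.
move=> x y; rewrite -[x]tens_classK -[y]tens_classK !tens_addE.
exact/tens_classP/tens_catC.
Qed.
Fact tens_add0 : left_id (tens_class [::]) tens_add.
Proof. by move=> x; rewrite -[x]tens_classK tens_addE. Qed.
Fact tens_addN : left_inverse (tens_class [::]) tens_opp tens_add.
Proof.
move=> x; rewrite -[x]tens_classK; elim: (repr x) => [|[a b] s IHs].
  by rewrite tens_oppE tens_addE.
have ACA u v w z : tens_add (tens_add u v) (tens_add w z)
                 = tens_add (tens_add u w) (tens_add v z).
  by rewrite -!tens_addA; congr tens_add; rewrite tens_addC -tens_addA;
     congr tens_add; rewrite tens_addC.
rewrite tens_oppE /= -cat1s -[(a, b) :: s]cat1s -!tens_addE -tens_oppE ACA IHs.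
rewrite [LHS]tens_addC tens_add0 tens_addE; apply/tens_classP.
apply: tens_trans (tens_zero b); rewrite -(addNr a).
exact/tens_sym/tens_addl.
Qed.

HB.instance Definition _ := GRing.isZmodule.Build tensor
  tens_addA tens_addC tens_add0 tens_addN.

Lemma tens_class_cat s t : tens_class (s ++ t) = tens_class s + tens_class t.
Proof. by rewrite -tens_addE. Qed.

Fact tens_scalingA k l x :
  tens_scaling k (tens_scaling l x) = tens_scaling (k * l) x.
Proof.
rewrite -[x]tens_classK !tens_scalingE -map_comp; congr tens_class.
by apply: eq_map => z /=; rewrite scalerA.
Qed.
Fact tens_scaling1 : left_id 1 tens_scaling.
Proof.
move=> x; rewrite -[x]tens_classK tens_scalingE; congr tens_class.
by rewrite -[RHS]map_id; apply: eq_map => -[a b] /=; rewrite scale1r.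
Qed.
Fact tens_scalingDr : right_distributive tens_scaling +%R.
Proof.
move=> k x y; rewrite -[x]tens_classK -[y]tens_classK.
by rewrite -tens_class_cat !tens_scalingE map_cat tens_class_cat.
Qed.
Fact tens_scalingDl x : {morph tens_scaling^~ x : k l / k + l}.
Proof.
move=> k l; rewrite -[x]tens_classK !tens_scalingE.
elim: (repr x) => [|[a b] s IHs] /=; first by rewrite -tens_class_cat.
have consE c t : tens_class (c :: t) = tens_class [:: c] + tens_class t.
  by rewrite -tens_class_cat.
rewrite consE IHs [X in _ = X + _]consE [X in _ = _ + X]consE addrACA.
congr (_ + _); rewrite -tens_class_cat; apply/tens_classP.
by rewrite scalerDl; apply: tens_addl.
Qed.

HB.instance Definition _ := GRing.Zmodule_isLmodule.Build R tensor
  tens_scalingA tens_scaling1 tens_scalingDr tens_scalingDl.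

Definition tens (x : M) (y : N) : tensor := tens_class [:: (x, y)].

Lemma tensDl x x' y : tens (x + x') y = tens x y + tens x' y.
Proof. by rewrite -tens_class_cat; apply/tens_classP/tens_addl. Qed.
Lemma tensDr x y y' : tens x (y + y') = tens x y + tens x y'.
Proof. by rewrite -tens_class_cat; apply/tens_classP/tens_addr. Qed.
Lemma tensZl k x y : tens (k *: x) y = k *: tens x y.
Proof. exact: esym (tens_scalingE k [:: (x, y)]). Qed.
Lemma tensZr k x y : tens x (k *: y) = k *: tens x y.
Proof. by rewrite -tensZl; apply/tens_classP/tens_sym/tens_scale. Qed.

Lemma tens_classE s : tens_class s = \sum_(z <- s) tens z.1 z.2.
Proof.
elim: s => [|[x y] s IHs]; first by rewrite big_nil.
by rewrite big_cons -cat1s tens_class_cat IHs.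
Qed.

Lemma tens_ind (P : tensor -> Prop) :
    P 0 -> (forall u v, P u -> P v -> P (u + v)) -> (forall x y, P (tens x y)) ->
  forall u, P u.
Proof.
move=> P0 PD Pt u; rewrite -[u]tens_classK tens_classE.
by elim/big_ind: _ => // z _.
Qed.

Definition bilinear_map (V : lmodType R) (f : M -> N -> V) : Prop :=
  [/\ forall x x' y, f (x + x') y = f x y + f x' y,
      forall x y y', f x (y + y') = f x y + f x y',
      forall k x y, f (k *: x) y = k *: f x y
    & forall k x y, f x (k *: y) = k *: f x y].

Lemma tens_bilinear : bilinear_map tens.
Proof. by split; [exact: tensDl|exact: tensDr|exact: tensZl|exact: tensZr]. Qed.

Section Lift.
Variables (V : lmodType R) (f : M -> N -> V).

Definition tens_lift (u : tensor) : V := \sum_(z <- repr u) f z.1 z.2.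

Hypothesis f_bil : bilinear_map f.

Lemma tens_cong_sum s t :
  tens_cong s t -> \sum_(z <- s) f z.1 z.2 = \sum_(z <- t) f z.1 z.2.
Proof.
case: f_bil => fDl fDr fZl fZr; elim=> {s t}.
- by [].
- by move=> s t _.
- by move=> s t u _ -> _.
- by move=> s s' t t' _ ss' _ tt'; rewrite !big_cat /= ss' tt'.
- by move=> s t; rewrite !big_cat /= addrC.
- by move=> y; rewrite big_seq1 big_nil /= -(scale0r 0) fZl scale0r.
- by move=> x x' y; rewrite !big_cons !big_nil !addr0 /= fDl.
- by move=> x y y'; rewrite !big_cons !big_nil !addr0 /= fDr.
- by move=> k x y; rewrite !big_seq1 /= fZl fZr.
Qed.

Lemma tens_lift_class s : tens_lift (tens_class s) = \sum_(z <- s) f z.1 z.2.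
Proof. exact/tens_cong_sum/repr_tens. Qed.

Lemma tens_liftE x y : tens_lift (tens x y) = f x y.
Proof. by rewrite tens_lift_class big_seq1. Qed.

Lemma tens_lift_is_linear : linear tens_lift.
Proof.
case: f_bil => _ _ fZl _ k u v.
rewrite -[u]tens_classK -[v]tens_classK -[k *: _]/(tens_scaling k _).
rewrite tens_scalingE -tens_class_cat !tens_lift_class big_cat big_map /=.
by rewrite scaler_sumr; congr (_ + _); apply: eq_bigr => z _; rewrite fZl.
Qed.

End Lift.

Lemma tens_universal (V : lmodType R) (f : M -> N -> V) :
    bilinear_map f ->
  exists2 g : {linear tensor -> V},
    forall x y, g (tens x y) = f x y &
    forall h : {linear tensor -> V}, (forall x y, h (tens x y) = f x y) -> h =1 g.
Proof.
move=> f_bil.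
pose gM := GRing.isLinear.Build _ _ _ _ (tens_lift f) (tens_lift_is_linear f_bil).
pose g : {linear tensor -> V} := HB.pack (tens_lift f) gM.
have gE x y : g (tens x y) = f x y by apply: tens_liftE.
exists g => // h hE u; elim/tens_ind: u => [|u v hu hv|x y].
- by rewrite !linear0.
- by rewrite !linearD hu hv.
- by rewrite hE gE.
Qed.

End Tensor.

Section TensorAlgebra.
Variables (R : comPzRingType) (A B : assocAlg R).

Definition tensor_ring : Type := tensor A B.
HB.instance Definition _ := GRing.Lmodule.copy tensor_ring (tensor A B).

Local Notation T := tensor_ring.
Local Notation "a ** b" := (tens (a : alg_lmod A) (b : alg_lmod B) : T)
  (at level 40).

Definition tens_mull (a : A) (b : B) : T -> T :=
  tens_lift (fun (a' : A) (b' : B) => (a * a') ** (b * b')).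

Definition tens_mul (u v : T) : T :=
  tens_lift (fun (a : A) (b : B) => tens_mull a b v) u.

Fact tens_mull_bilinear (a : A) (b : B) :
  bilinear_map (fun (a' : A) (b' : B) => (a * a') ** (b * b')).
Proof.
split=> [x x' y|x y y'|k x y|k x y].
- by rewrite mulrDr tensDl.
- by rewrite mulrDr tensDr.
- by rewrite -alg_scaleAr tensZl.
- by rewrite -alg_scaleAr tensZr.
Qed.

Lemma tens_mullE (a a' : A) (b b' : B) :
  tens_mull a b (a' ** b') = (a * a') ** (b * b').
Proof. exact: (tens_liftE (tens_mull_bilinear a b)). Qed.

Lemma tens_mull_linear a b : linear (tens_mull a b).
Proof. exact: (tens_lift_is_linear (tens_mull_bilinear a b)). Qed.

Lemma tens_mullD a b u v : tens_mull a b (u + v) = tens_mull a b u + tens_mull a b v.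
Proof. by have := tens_mull_linear a b 1 u v; rewrite !scale1r. Qed.

Lemma tens_mull0 a b : tens_mull a b 0 = 0.
Proof. by apply: (addrI (tens_mull a b 0)); rewrite -tens_mullD !addr0. Qed.

Lemma tens_mullZ k a b u : tens_mull a b (k *: u) = k *: tens_mull a b u.
Proof. by have := tens_mull_linear a b k u 0; rewrite tens_mull0 !addr0. Qed.

Fact tens_mul_bilinear v :
  bilinear_map (fun (a : A) (b : B) => tens_mull a b v : T).
Proof.
split=> [x x' y|x y y'|k x y|k x y]; elim/tens_ind: v => [|u v hu hv|a b].
- by rewrite !tens_mull0 addr0.
- by rewrite !tens_mullD hu hv addrACA.
- by rewrite !tens_mullE mulrDl tensDl.
- by rewrite !tens_mull0 addr0.
- by rewrite !tens_mullD hu hv addrACA.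
- by rewrite !tens_mullE mulrDl tensDr.
- by rewrite !tens_mull0 scaler0.
- by rewrite !tens_mullD hu hv scalerDr.
- by rewrite !tens_mullE -alg_scaleAl tensZl.
- by rewrite !tens_mull0 scaler0.
- by rewrite !tens_mullD hu hv scalerDr.
- by rewrite !tens_mullE -alg_scaleAl tensZr.
Qed.

Lemma tens_mulE (a a' : A) (b b' : B) :
  tens_mul (a ** b) (a' ** b') = (a * a') ** (b * b').
Proof. by rewrite /tens_mul (tens_liftE (tens_mul_bilinear _)) tens_mullE. Qed.

Lemma tens_mul_linearl v : linear (tens_mul^~ v).
Proof. exact: (tens_lift_is_linear (tens_mul_bilinear v)). Qed.

Lemma tens_mulDl : left_distributive tens_mul +%R.
Proof.
by move=> u v w; have := tens_mul_linearl w 1 u v; rewrite !scale1r.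
Qed.

Lemma tens_mul0l v : tens_mul 0 v = 0.
Proof. by apply: (addrI (tens_mul 0 v)); rewrite -tens_mulDl !addr0. Qed.

Lemma tens_mulZl k u v : tens_mul (k *: u) v = k *: tens_mul u v.
Proof. by have := tens_mul_linearl v k u 0; rewrite tens_mul0l !addr0. Qed.

Lemma tens_mulDr : right_distributive tens_mul +%R.
Proof.
move=> u v w; elim/tens_ind: u => [|u u' hu hu'|a b].
- by rewrite !tens_mul0l addr0.
- by rewrite !tens_mulDl hu hu' addrACA.
- by rewrite /tens_mul !(tens_liftE (tens_mul_bilinear _)) tens_mullD.
Qed.

Lemma tens_mul0r v : tens_mul v 0 = 0.
Proof. by apply: (addrI (tens_mul v 0)); rewrite -tens_mulDr !addr0. Qed.

Lemma tens_mulZr k u v : tens_mul u (k *: v) = k *: tens_mul u v.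
Proof.
elim/tens_ind: u => [|u u' hu hu'|a b].
- by rewrite !tens_mul0l scaler0.
- by rewrite !tens_mulDl hu hu' scalerDr.
- by rewrite /tens_mul !(tens_liftE (tens_mul_bilinear _)) tens_mullZ.
Qed.

Fact tens_mulA : associative tens_mul.
Proof.
move=> u v w; elim/tens_ind: u => [|u u' hu hu'|a b].
- by rewrite !tens_mul0l.
- by rewrite !tens_mulDl hu hu'.
elim/tens_ind: v => [|v v' hv hv'|a' b'].
- by rewrite !(tens_mul0l, tens_mul0r).
- by rewrite !(tens_mulDl, tens_mulDr) hv hv'.
elim/tens_ind: w => [|w w' hw hw'|a'' b''].
- by rewrite !tens_mul0r.
- by rewrite !tens_mulDr hw hw'.
- by rewrite !tens_mulE !mulrA.
Qed.

Fact tens_mul1l : left_id (1 ** 1) tens_mul.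
Proof.
elim/tens_ind=> [|u v hu hv|a b].
- by rewrite tens_mul0r.
- by rewrite tens_mulDr hu hv.
- by rewrite tens_mulE !mul1r.
Qed.

Fact tens_mul1r : right_id (1 ** 1) tens_mul.
Proof.
elim/tens_ind=> [|u v hu hv|a b].
- by rewrite tens_mul0l.
- by rewrite tens_mulDl hu hv.
- by rewrite tens_mulE !mulr1.
Qed.

HB.instance Definition _ := GRing.Zmodule_isPzRing.Build tensor_ring
  tens_mulA tens_mul1l tens_mul1r tens_mulDl tens_mulDr.

(* The module structure that assocAlg derives from this map is the one of the *)
(* tensor product of modules: see tensor_alg_scale.                           *)
Definition tensor_map (k : R) : T := k *: (1 : T).

Fact tensor_map_zmod : zmod_morphism tensor_map.
Proof. by move=> k l; rewrite /tensor_map scalerBl. Qed.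
Fact tensor_map_monoid : monoid_morphism tensor_map.
Proof.
split=> [|k l]; first exact: scale1r.
rewrite /tensor_map -[RHS]/(tens_mul (k *: (1 : T)) (l *: (1 : T))) tens_mulZl tens_mulZr.
by rewrite -scalerA; congr (_ *: (_ *: _)); apply/esym/tens_mul1l.
Qed.

HB.instance Definition _ := GRing.isZmodMorphism.Build R tensor_ring tensor_map
  tensor_map_zmod.
HB.instance Definition _ := GRing.isMonoidMorphism.Build R tensor_ring tensor_map
  tensor_map_monoid.

Fact tensor_mapE k (u : T) : tensor_map k * u = k *: u.
Proof. by rewrite -[LHS]/(tens_mul _ _) tens_mulZl; congr (_ *: _); apply: mul1r. Qed.

Fact tensor_mapC k (u : T) : tensor_map k * u = u * tensor_map k.
Proof.
rewrite tensor_mapE -[RHS]/(tens_mul _ _) tens_mulZr; congr (_ *: _).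
by apply: esym; apply: mulr1.
Qed.

Definition tensor_alg : assocAlg R :=
  @AssocAlg R tensor_ring tensor_map tensor_mapC.

Lemma tensor_alg_scale (k : R) (u : tensor A B) :
  k *: (u : tensor_alg) = k *: u :> tensor A B.
Proof. exact: tensor_mapE. Qed.

Lemma tensor_alg_mul (a a' : A) (b b' : B) :
  (tens (a : alg_lmod A) (b : alg_lmod B) : tensor_alg) *
  (tens (a' : alg_lmod A) (b' : alg_lmod B) : tensor_alg)
  = tens (a * a' : alg_lmod A) (b * b' : alg_lmod B).
Proof. exact: tens_mulE. Qed.

End TensorAlgebra.

(* Main.v *)
From HB Require Import structures.
From mathcomp Require Import all_boot all_algebra.
From mathcomp Require Import boolp.
Require Import Defs.

(** Localize at [p]: it remains to bound the injective dimension of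
    [T = A (x) B] over itself when [A] and [B] are finite projective over [R]
    and have finite injective dimension over themselves.  For a right
    [B]-module [N] and a left [A]-module [Y], [Hom_R(N, Y)] is a [T]-module; it
    is injective if [N] is free and [Y] is injective.  Let [D = Hom_R(-, R)].
    Take a resolution of the right module [D B] by finitely generated free
    modules, with syzygies [K_0 = D B], [K_1], and so on.  Its dual is a
    coresolution of [D K_0 = B] by modules that are injective relative to
    [R]-projective modules, so [Ext^1(M, D K_n) = Ext^(n+1)(M, B)] for
    [R]-projective [M]; this vanishes when [n] is the injective dimension of
    [B], and for [M = D K_(n+1)] it makes [K_n] projective.  Applying
    [Hom_R(-, A)], which is exact on [R]-projective modules, to this finite
    projective resolution of [D B] gives a finite coresolution of
    [Hom_R(D B, A) = T] by modules of finite injective dimension. *)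

Set Implicit Arguments.
Unset Strict Implicit.
Unset Printing Implicit Defensive.

Import GRing.Theory.
Local Open Scope ring_scope.

(** * Submodules, kernels and short exact sequences *)

Section Linear.
Variable S : pzRingType.

Definition mklin (U V : lmodType S) (f : U -> V) (lf : linear f) :
    {linear U -> V} :=
  HB.pack f (GRing.isLinear.Build S U V *:%R f lf).

(** The closure proof [PS] is a parameter of the type so that the module structure attached to it
    can be inferred. *)
Definition subm (V : lmodType S) (P : V -> Prop) (PS : submodule P) : Type :=
  {x : V | P x}.

Section Submodule.
Variables (V : lmodType S) (P : V -> Prop) (PS : submodule P).
Local Notation subm := (subm PS).

HB.instance Definition _ := gen_eqMixin subm.
HB.instance Definition _ := gen_choiceMixin subm.

Lemma subm_inj (x y : subm) : sval x = sval y -> x = y.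
Proof. by case: x y => [x Px] [y Py] /= xy; apply: eq_exist. Qed.

Lemma submD x y : P x -> P y -> P (x + y).
Proof. by move=> Px Py; rewrite -(scale1r x); apply: PS.2. Qed.

Lemma submZ a x : P x -> P (a *: x).
Proof. by move=> Px; rewrite -(addr0 (a *: x)); apply: PS.2 => //;
  case: PS. Qed.

Lemma submN x : P x -> P (- x).
Proof. by move=> Px; rewrite -scaleN1r; apply: submZ. Qed.

Definition subm0 : subm := exist P 0 PS.1.
Definition subm_add (x y : subm) : subm :=
  exist P (sval x + sval y) (submD (svalP x) (svalP y)).
Definition subm_opp (x : subm) : subm := exist P (- sval x) (submN (svalP x)).
Definition subm_scale a (x : subm) : subm :=
  exist P (a *: sval x) (submZ a (svalP x)).

Fact subm_addA : associative subm_add.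
Proof. by move=> x y z; apply: subm_inj; rewrite /= addrA. Qed.
Fact subm_addC : commutative subm_add.
Proof. by move=> x y; apply: subm_inj; rewrite /= addrC. Qed.
Fact subm_add0 : left_id subm0 subm_add.
Proof. by move=> x; apply: subm_inj; rewrite /= add0r. Qed.
Fact subm_addN : left_inverse subm0 subm_opp subm_add.
Proof. by move=> x; apply: subm_inj; rewrite /= addNr. Qed.
HB.instance Definition _ := GRing.isZmodule.Build subm
  subm_addA subm_addC subm_add0 subm_addN.

Fact subm_scaleA a b x : subm_scale a (subm_scale b x) = subm_scale (a * b) x.
Proof. by apply: subm_inj; rewrite /= scalerA. Qed.
Fact subm_scale1 : left_id 1 subm_scale.
Proof. by move=> x; apply: subm_inj; rewrite /= scale1r. Qed.
Fact subm_scaleDr : right_distributive subm_scale +%R.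
Proof. by move=> a x y; apply: subm_inj; rewrite /= scalerDr. Qed.
Fact subm_scaleDl x : {morph subm_scale^~ x : a b / a + b}.
Proof. by move=> a b; apply: subm_inj; rewrite /= scalerDl. Qed.
HB.instance Definition _ := GRing.Zmodule_isLmodule.Build S subm
  subm_scaleA subm_scale1 subm_scaleDr subm_scaleDl.

Lemma subm_val_linear : linear (fun x : subm => sval x).
Proof. by []. Qed.
Definition subm_val : {linear subm -> V} := mklin subm_val_linear.

End Submodule.

Definition ses (X Y Z : lmodType S) (i : X -> Y) (p : Y -> Z) : Prop :=
  [/\ injective i, forall z, exists y, p y = z
    & forall y, p y = 0 <-> exists x, y = i x].

Lemma ker_submodule (Y Z : lmodType S) (p : {linear Y -> Z}) :
  submodule (fun y => p y = 0).
Proof.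
by split=> [|a x y px py]; rewrite ?linear0 // linearP px py scaler0 addr0.
Qed.

Definition ker (Y Z : lmodType S) (p : {linear Y -> Z}) : lmodType S :=
  subm (ker_submodule p).
Definition ker_val (Y Z : lmodType S) (p : {linear Y -> Z}) :
  {linear ker p -> Y} := subm_val (ker_submodule p).

Lemma ses_ker (Y Z : lmodType S) (p : {linear Y -> Z}) :
  (forall z, exists y, p y = z) -> ses (ker_val p) p.
Proof.
move=> ps; split=> // [x y|y]; first exact: subm_inj.
by split=> [py|[[x px] ->]] //; exists (exist _ y py).
Qed.

Lemma ses_comp0 (X Y Z : lmodType S) (i : X -> Y) (p : Y -> Z) x :
  ses i p -> p (i x) = 0.
Proof. by case=> _ _ h; apply/h; exists x. Qed.

(** Injectivity of [i] makes any choice of preimages linear. *)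
Lemma linear_lift (W X Y : lmodType S) (i : {linear X -> Y})
    (f : {linear W -> Y}) :
    injective i -> (forall w, exists x, f w = i x) ->
  exists g : {linear W -> X}, forall w, f w = i (g w).
Proof.
move=> iI fi; have [g gE] := choice fi.
have gL : linear g by move=> a x y; apply: iI; rewrite linearP -!gE linearP.
by exists (mklin gL).
Qed.

(** Compose [f] with a set-theoretic section of [p]: the result is linear because [f] is constant on
    the fibres of [p]. *)
Lemma linear_factor (X Y Z : lmodType S) (p : {linear X -> Y})
    (f : {linear X -> Z}) :
    (forall y, exists x, p x = y) -> (forall x, p x = 0 -> f x = 0) ->
  exists g : {linear Y -> Z}, forall x, g (p x) = f x.
Proof.
move=> ps pf; have [s sE] := choice ps.
have fE x x' : p x = p x' -> f x = f x'.
  by move=> e; apply/eqP; rewrite -subr_eq0 -linearB pf // linearB e subrr.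
have gL : linear (fun y => f (s y)).
  by move=> a x y; rewrite -linearP; apply: fE; rewrite linearP !sE.
by exists (mklin gL) => x; apply: fE; rewrite sE.
Qed.

Lemma zero_linear (U V : lmodType S) : linear (fun _ : U => 0 : V).
Proof. by move=> a x y /=; rewrite scaler0 addr0. Qed.

(** * Injective modules and finite injective dimension *)

Definition zero_module : lmodType S := {ffun void -> S^o}.

Lemma zero_moduleP (x : zero_module) : x = 0.
Proof. by apply/ffunP=> -[]. Qed.

Lemma injective_zero (M : lmodType S) :
  (forall x : M, x = 0) -> injective_module M.
Proof.
move=> M0 X Y i g _.
by exists (mklin (@zero_linear Y M)) => x; rewrite (M0 (g x)).
Qed.

Lemma injective_iso (M E : lmodType S) (f : {linear M -> E}) :
  bijective f -> injective_module E -> injective_module M.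
Proof.
case=> f' fK f'K EI X Y i g iI; have [h hE] := EI X Y i (f \o g) iI.
have [|k kE] := @linear_lift Y M E f h (can_inj fK).
  by move=> w; exists (f' (h w)); rewrite f'K.
by exists k => x; apply: (can_inj fK); rewrite -kE hE.
Qed.

Lemma injective_prod (M N : lmodType S) :
  injective_module M -> injective_module N -> injective_module (M * N)%type.
Proof.
move=> MI NI X Y i g iI.
have [h hE] := MI X Y i (fst \o g) iI; have [k kE] := NI X Y i (snd \o g) iI.
have hkL : linear (fun y => (h y, k y)) by move=> a x y; rewrite !linearP.
by exists (mklin hkL) => x /=; rewrite hE kE /=; case: (g x).
Qed.

(** Injective dimension at most n, unfolded one cosyzygy at a time. This is the form used in
    inductions; [finite_injdimE] connects it with resolutions. *)
Fixpoint fid (n : nat) (M : lmodType S) : Prop :=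
  if n is n'.+1 then
    exists (I M' : lmodType S) (i : {linear M -> I}) (p : {linear I -> M'}),
      [/\ injective_module I, ses i p & fid n' M']
  else injective_module M.

Lemma fid_iso n (M N : lmodType S) (f : {linear M -> N}) :
  bijective f -> fid n N -> fid n M.
Proof.
move=> fB; have [f' fK f'K] := fB.
case: n => [|n] /=; first exact: injective_iso fB.
case=> I [M' [i [p [II [iI ps ip] M'n]]]]; exists I, M', (i \o f), p;
  split=> //.
split=> // [x y /iI /(can_inj fK) //|y]; apply: (iff_trans (ip y)).
by split=> -[x ->]; [exists (f' x); rewrite /= f'K|exists (f x)].
Qed.

Lemma fidS n M : fid n M -> fid n.+1 M.
Proof.
elim: n M => [|n IHn] M.
  move=> MI; exists M, zero_module, (idfun : {linear M -> M}), (mklin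
    (@zero_linear M zero_module)); split=> //.
    split=> // [z|y]; first by exists 0; rewrite (zero_moduleP z).
    by split=> // _; exists y.
  exact: injective_zero zero_moduleP.
by case=> I [M' [i [p [II ip M'n]]]]; exists I, M', i, p; split=> //;
  apply: IHn.
Qed.

Lemma fid_leq m n M : (m <= n)%N -> fid m M -> fid n M.
Proof.
by move=> /subnK <-; elim: (n - m)%N => // k IHk /IHk; rewrite addSn;
  apply: fidS.
Qed.

Lemma fid_prod n (M J : lmodType S) :
  injective_module J -> fid n M -> fid n (M * J)%type.
Proof.
move=> JI; case: n => [|n] /=; first by move=> MI; apply: injective_prod.
case=> I [M' [i [p [II [iI ps ip] M'n]]]].
have jL : linear (fun x : M * J => (i x.1, x.2)).
  by move=> a x y /=; rewrite linearP.
exists (I * J)%type, M', (mklin jL), (p \o fst); split=> //.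
  exact: injective_prod.
split=> [[x1 x2] [y1 y2] [/iI -> ->] //|z|[y1 y2]] /=.
  by have [y <-] := ps z; exists (y, 0).
apply: (iff_trans (ip y1)); split=> [[x ->]|[[x1 x2] [-> _]]];
  last by exists x1.
by exists (x, y2).
Qed.

(* With 0 -> N -> I -> N' -> 0 and 0 -> C -> J -> C' -> 0, the cokernel of    *)
(* M -> I is the fibre product of N' and J over C'.                           *)
Lemma fid_ker n (M N C : lmodType S) (j : {linear M -> N})
    (f : {linear N -> C}) :
  ses j f -> fid n N -> fid n C -> fid n.+1 M.
Proof.
elim: n M N C j f => [|n IHn] M N C j f jf; first by move=> NI CI;
  exists N, C, j, f.
case=> I [N' [i [p [II ip N'n]]]] [J [C' [k [q [JI kq C'n]]]]].
have [jI fs jfE] := jf; have [iI ps ipE] := ip; have [kI qs kqE] := kq.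
have [h hE] := JI _ _ i (k \o f) iI.
have [|h' h'E] := @linear_factor I N' C' p (q \o h) ps.
  by move=> _ /ipE[y ->] /=; rewrite hE; apply/kqE; exists (f y).
pose d : {linear (N' * J)%type -> C'} := (h' \o fst) \- (q \o snd).
pose Q := ker d.
have ds z : exists y, d y = z.
  by have [y yE] := qs (- z); exists (0, y); rewrite /= yE linear0 sub0r opprK.
(* [Q] sits in 0 -> Q -> N' x J -> C' -> 0, where the other two terms have dimension at most n, so
   the induction hypothesis applies to it. *)
have Qn : fid n.+1 Q.
  by apply: IHn (ses_ker ds) _ C'n; apply: fid_prod.
have ePL : linear (fun x => (p x, h x)) by move=> a x y; rewrite !linearP.
pose eP : {linear I -> (N' * J)%type} := mklin ePL.
have dval_inj : injective (ker_val d) by move=> x y; apply: subm_inj.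
have [|e eE] := @linear_lift I Q (N' * J)%type (ker_val d) eP dval_inj.
  move=> x; have dx : d (eP x) = 0 by rewrite /= h'E /= subrr.
  by exists (exist _ (eP x) dx).
exists I, Q, (i \o j), e; split=> //; split.
- by move=> x y /iI /jI.
- case=> [[u v] uvE]; have [x xu] := ps u.
  have : q (v - h x) = 0.
    by rewrite linearB /=; move: uvE => /= /eqP;
      rewrite subr_eq0 -xu h'E => /eqP /= ->; rewrite subrr.
  case/kqE=> c cE; have [y yc] := fs c.
  (* Adding [i y] keeps the image under [p] and changes the value of [h] by [k (f y)], which is the
     error in the second coordinate. *)
  exists (x + i y); apply: dval_inj; rewrite -eE /=.
  by rewrite !linearD /= (ses_comp0 y ip) addr0 xu hE /= yc -cE addrCA subrr
    addr0.
- move=> x; split=> [ex|[m ->]].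
    have := eE x; rewrite ex linear0 => -[/ipE[y xy] hx].
    move: hx; rewrite xy hE /= -(linear0 k) => /kI /jfE[m ym].
    by exists m; rewrite /= -ym.
  apply: dval_inj; rewrite -eE linear0 /= (ses_comp0 _ ip) hE /=.
  by rewrite (ses_comp0 _ jf) linear0.
Qed.

(** The first cosyzygy is the kernel of d^1, which is the image of d^0 by exactness; the shifted
    complex resolves it. For n = 0, the vanishing of I^1 makes [eps] surjective. *)
Lemma injdim_le_fid n M : injdim_le M n -> fid n M.
Proof.
elim: n M => [|n IHn] M [I [eps [d [II epsI d0 dS I0]]]].
  apply: (@injective_iso M (I 0%N) eps) => //.
  have epss x : exists m, eps m = x.
    by have [m ->] : exists m, x = eps m; [apply/d0; exact: I0|exists m].
  have [g gE] := choice epss; exists g => // m; apply: epsI; exact: gE.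
pose K := ker (d 1%N).
have kI : injective (ker_val (d 1%N)) by move=> x y; apply: subm_inj.
have [|e eE] := @linear_lift (I 0%N) K (I 1%N) (ker_val (d 1%N)) (d 0%N) kI.
  move=> x; have dx : d 1%N (d 0%N x) = 0 by apply/dS; exists x.
  by exists (exist _ (d 0%N x) dx).
exists (I 0%N), K, eps, e; split=> //.
  split=> // [[z dz]|y].
    by have [y zy] := (dS 0%N z).1 dz; exists y; apply: kI; rewrite -eE.
  rewrite -d0 eE; split=> [->|h]; first by rewrite linear0.
  by apply: kI; rewrite linear0.
apply: IHn; exists (fun k => I k.+1), (ker_val (d 1%N)), (fun k => d k.+1).
split=> // [x|k kn x]; last exact: I0.
split=> [dx|[[m dm] ->]] //; first by exists (exist _ x dx).
Qed.

Lemma fid_injdim_le n M : fid n M -> injdim_le M n.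
Proof.
elim: n M => [|n IHn] M.
  move=> MI; pose I k : lmodType S := if k is 0 then M else zero_module.
  exists I, (idfun : {linear M -> M}), (fun k => mklin (@zero_linear (I k)
    (I k.+1))); split=> //.
  - by case=> //= _; apply: injective_zero zero_moduleP.
  - by move=> x; split=> // _; exists x.
  - by move=> k x; split=> // _; exists 0; apply: zero_moduleP.
  - by case=> // k _; apply: zero_moduleP.
case=> J [M' [i [p [JI [iI ps ip] /IHn[I [eps [d [II epsI d0 dS I0]]]]]]]].
pose I1 k : lmodType S := if k is k'.+1 then I k' else J.
pose d1 k : {linear I1 k -> I1 k.+1} :=
  match k with 0 => eps \o p | k'.+1 => d k' end.
exists I1, i, d1; split=> //.
- by case.
- move=> x; rewrite -ip /=; split=> [h|->]; last by rewrite linear0.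
  by apply: epsI; rewrite linear0.
- case=> [|k] x; last exact: dS.
  apply: (iff_trans (d0 x)); split=> -[y ->]; last by exists (p y).
  by have [z <-] := ps y; exists z.
- by case=> // k; apply: I0.
Qed.

Lemma finite_injdimE M : finite_injdim M <-> exists n, fid n M.
Proof.
by split=> -[n h]; exists n; [apply: injdim_le_fid|apply: fid_injdim_le].
Qed.

(** * Free modules and vanishing of Ext *)

Definition freemod (J : finType) : lmodType S := {ffun J -> S^o}.

Definition basis (J : finType) (j : J) : freemod J := [ffun k => (k == j)%:R].

Lemma free_sum (J : finType) (v : freemod J) : v = \sum_j (v j : S) *: basis j.
Proof.
apply/ffunP=> k; rewrite sum_ffunE (bigD1 k) //= !ffunE eqxx big1 ?addr0.
  exact: esym (mulr1 _).
by move=> j /negPf jk; rewrite !ffunE eq_sym jk; apply: mulr0.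
Qed.

Lemma free_map (J : finType) (M : lmodType S) (x : J -> M) :
  exists f : {linear freemod J -> M},
    (forall v, f v = \sum_j (v j : S) *: x j) /\ (forall j, f (basis j) = x j).
Proof.
have fL : linear (fun v : freemod J => \sum_j (v j : S) *: x j).
  move=> a u v; rewrite scaler_sumr -big_split; apply: eq_bigr => j _ /=.
  by rewrite !ffunE scalerDl scalerA.
exists (mklin fL); split=> //= j.
rewrite (bigD1 j) //= ffunE eqxx scale1r big1 ?addr0 // => k /negPf kj.
by rewrite ffunE kj scale0r.
Qed.

Lemma free_lift (J : finType) (X Y : lmodType S) (p : {linear X -> Y})
    (g : {linear freemod J -> Y}) :
  (forall y, exists x, p x = y) -> exists h : {linear freemod J ->
    X}, forall v, p (h v) = g v.
Proof.
move=> ps; have /choice[x xE] j := ps (g (basis j)).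
have [h [hE hb]] := free_map x; exists h => v.
by rewrite [v in RHS]free_sum hE !linear_sum; apply: eq_bigr => j _;
  rewrite !linearZ xE.
Qed.

(* [Ext^(n+1)(M, Y) = 0], read off syzygies in finitely generated free       *)
(* covers; vacuous if some syzygy has no such cover.                          *)
Fixpoint extv (n : nat) (M Y : lmodType S) : Prop :=
  forall (J : finType) (K : lmodType S) (i : {linear K -> freemod J})
      (p : {linear freemod J -> M}), ses i p ->
    if n is n'.+1 then extv n' K Y
    else forall g : {linear K -> Y}, exists h : {linear freemod J ->
      Y}, forall x, h (i x) = g x.

Lemma extv_injective (M Y : lmodType S) : injective_module Y -> extv 0 M Y.
Proof. by move=> YI J K i p [iI _ _] g; apply: YI. Qed.

(** Dimension shift in the second variable. For n = 0: extend [g] into [I] over the second cover,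
    push the extension to [Y'], extend over the first cover by hypothesis, and lift this to [I] by
    freeness. Subtracting the lift brings the values back into [Y] and changes nothing on [K1]. *)
Lemma extv_shift n (M Y I Y' : lmodType S) (a : {linear Y -> I})
    (b : {linear I -> Y'}) :
  ses a b -> injective_module I -> extv n M Y' -> extv n.+1 M Y.
Proof.
move=> ab II; elim: n M => [|n IHn] M MY; last first.
  by move=> J K i p ip; apply: IHn; apply: MY ip.
move=> J K i p ip J1 K1 i1 p1 ip1 g.
have [aI bs abE] := ab; have [iI ps ipE] := ip; have [i1I p1s ip1E] := ip1.
have [h hE] := II _ _ i1 (a \o g) i1I.
have [|k kE] := @linear_factor _ _ _ p1 (b \o h) p1s.
  by move=> _ /ip1E[x ->]; rewrite /= hE /=; apply: ses_comp0 ab.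
have [l lE] := MY _ _ _ _ ip k.
have [w wE] := free_lift l bs.
have [|v vE] := @linear_lift _ _ _ a (h \- (w \o i \o p1)) aI.
  by move=> x; apply/abE; rewrite /= linearB wE lE kE subrr.
exists v => x; apply: aI; rewrite -vE /= (ses_comp0 _ ip1) !linear0 addr0.
by rewrite hE.
Qed.

Lemma fid_extv n (M Y : lmodType S) : fid n Y -> extv n M Y.
Proof.
elim: n M Y => [|n IHn] M Y; first exact: extv_injective.
by case=> I [Y' [a [b [II ab /IHn h]]]]; apply: extv_shift ab II (h M).
Qed.

(** A lift of the cover [c] to [Z] sends ker c into [Y]. Extending this restriction to the whole
    cover and subtracting it makes the lift factor through [M], which gives a section [s] of [b];
    the retraction comes from id - s b. *)
Lemma extv0_split (J : finType) (Y Z M : lmodType S) (a : {linear Y -> Z})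
    (b : {linear Z -> M}) (c : {linear freemod J -> M}) :
    ses a b -> (forall x, exists v, c v = x) -> extv 0 M Y ->
  exists r : {linear Z -> Y}, forall y, r (a y) = y.
Proof.
move=> ab cs MY; have [aI bs abE] := ab; have [l lE] := free_lift c bs.
have cK := ses_ker cs; have [|g gE] := @linear_lift _ _ _ a (l \o ker_val c) aI.
  by move=> x; apply/abE; rewrite /= lE; apply: ses_comp0 cK.
have [h hE] := MY _ _ _ _ cK g.
have [|s sE] := @linear_factor _ _ _ c (l \- (a \o h)) cs.
  by case: cK => _ _ cKE _ /cKE[x ->]; rewrite /= hE -gE subrr.
have bs_id x : b (s x) = x.
  have [v <-] := cs x; rewrite sE /= linearB lE; apply/eqP.
  by rewrite subr_eq addrC -subr_eq subrr (ses_comp0 _ ab).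
have [|r rE] := @linear_lift _ _ _ a (idfun \- (s \o b)) aI.
  by move=> z; apply/abE; rewrite /= linearB bs_id subrr.
by exists r => y; apply: aI; rewrite -rE /= (ses_comp0 _ ab) linear0 subr0.
Qed.

End Linear.

(** * Restriction of scalars *)

Definition restr (A T : pzRingType) (phi : {rmorphism A -> T})
    (X : lmodType T) :
  Type := X.

Section Restriction.
Variables (A T : pzRingType) (phi : {rmorphism A -> T}) (X : lmodType T).

HB.instance Definition _ := GRing.Zmodule.copy (restr phi X) X.

Definition restr_scale (a : A) (x : restr phi X) : restr phi X :=
  phi a *: (x : X).

Fact restr_scaleA a b x : restr_scale a (restr_scale b x) = restr_scale
    (a * b) x.
Proof. by rewrite /restr_scale scalerA rmorphM. Qed.
Fact restr_scale1 : left_id 1 restr_scale.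
Proof. by move=> x; rewrite /restr_scale rmorph1 scale1r. Qed.
Fact restr_scaleDr : right_distributive restr_scale +%R.
Proof. by move=> a x y; apply: scalerDr. Qed.
Fact restr_scaleDl x : {morph restr_scale^~ x : a b / a + b}.
Proof. by move=> a b; rewrite /restr_scale rmorphD scalerDl. Qed.
HB.instance Definition _ := GRing.Zmodule_isLmodule.Build A (restr phi X)
  restr_scaleA restr_scale1 restr_scaleDr restr_scaleDl.

Lemma restrZ (a : A) (x : restr phi X) : a *: x = phi a *: (x : X).
Proof. by []. Qed.

End Restriction.

(** * R-linear maps and modules finitely generated projective over R *)

Section RLinear.
Variable R : comPzRingType.

(** R-linearity between modules over two different R-algebras. The R-actions pass through [rS] and
    [rA], so that both modules keep their own structures. *)
Definition rlinear (A S : pzRingType) (rA : {rmorphism R -> A})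
    (rS : {rmorphism R -> S}) (N : lmodType S) (Y : lmodType A) (f : N -> Y) :=
  forall r x y, f (rS r *: x + y) = rA r *: f x + f y.

Section Theory.
Variables (A S : pzRingType) (rA : {rmorphism R -> A})
    (rS : {rmorphism R -> S}).
Variables (N : lmodType S) (Y : lmodType A) (f : N -> Y).
Hypothesis fL : rlinear rA rS f.

Lemma rlinearD x y : f (x + y) = f x + f y.
Proof. by have := fL 1 x y; rewrite !rmorph1 !scale1r. Qed.

Lemma rlinear0 : f 0 = 0.
Proof. by apply: (addrI (f 0)); rewrite -rlinearD !addr0. Qed.

Lemma rlinearZ r x : f (rS r *: x) = rA r *: f x.
Proof. by have := fL r x 0; rewrite rlinear0 !addr0. Qed.

Lemma rlinear_sum (I : finType) (F : I -> N) : f (\sum_i F i) = \sum_i f (F i).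
Proof. by apply: (big_morph f rlinearD rlinear0). Qed.

End Theory.

(* Finitely generated projective over R, in terms of a dual basis. *)
Definition lattice (S : pzRingType) (rS : {rmorphism R -> S}) (N : lmodType S) :
    Prop :=
  exists (J : finType) (x : J -> N) (phi : J -> N -> R^o),
    (forall j, rlinear idfun rS (phi j)) /\
    forall n, n = \sum_j rS (phi j n) *: x j.

Section Lattice.
Variables (S : pzRingType) (rS : {rmorphism R -> S}).

(** The dual basis of [N] gives an R-linear section [sg] of [p], and v - sg (p v) is then the
    projection onto [K]. The splitting is over R only, not over [S]. *)
Lemma lattice_retract (K F N : lmodType S) (i : {linear K -> F})
    (p : {linear F -> N}) :
  ses i p -> lattice rS N -> exists2 rho : F -> K, rlinear rS rS rho &
    forall k, rho (i k) = k.
Proof.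
move=> [iI ps ipE] [J [x [phi [phiL xE]]]].
have /choice[y yE] j := ps (x j).
pose sg n := \sum_j rS (phi j n) *: y j.
have psg n : p (sg n) = n.
  rewrite [RHS]xE linear_sum; apply: eq_bigr => j _; by rewrite linearZ yE.
have sgL : rlinear rS rS sg.
  move=> r u v; rewrite /sg scaler_sumr -big_split; apply: eq_bigr => j _ /=.
  by rewrite phiL rmorphD scalerDl rmorphM scalerA.
have /choice[rho rhoE] v : exists k, v - sg (p v) = i k.
  by apply/ipE; rewrite linearB psg subrr.
exists rho => [r u v|k]; apply: iI; last first.
  by rewrite -rhoE (_ : p (i k) = 0) ?(rlinear0 sgL) ?subr0 //; apply/ipE;
    exists k.
by rewrite linearP -!rhoE linearP sgL scalerBr opprD addrACA.
Qed.

(** An R-linear retract inherits a dual basis: push the vectors forward by [rho] and restrict the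
    functionals along [i]. *)
Lemma lattice_ker (K F N : lmodType S) (i : {linear K -> F})
    (p : {linear F -> N}) :
  ses i p -> lattice rS N -> lattice rS F -> lattice rS K.
Proof.
move=> ip /(lattice_retract ip)[rho rhoL rhoK] [J [x [phi [phiL xE]]]].
exists J, (rho \o x), (fun j k => phi j (i k)); split=> [j r u v|k].
  by rewrite linearP phiL.
rewrite -[LHS]rhoK [i k in LHS]xE (rlinear_sum rhoL).
by apply: eq_bigr => j _; rewrite (rlinearZ rhoL).
Qed.

Lemma lattice_free (J : finType) : lattice rS (S^o : lmodType S) ->
    lattice rS (freemod S J).
Proof.
case=> [I [b [phi [phiL bE]]]].
exists (I * J)%type, (fun ij => (b ij.1 : S) *: basis S ij.2),
  (fun ij (v : freemod S J) => phi ij.1 (v ij.2)).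
split=> [j r u v|v]; first by rewrite !ffunE phiL.
rewrite [LHS]free_sum -(pair_big xpredT xpredT
  (fun i j => rS (phi i (v j)) *: (b i *: basis S j))) /= exchange_big.
apply: eq_bigr => j _; rewrite [v j in LHS]bE scaler_suml.
by apply: eq_bigr => i _; rewrite scalerA.
Qed.

Lemma lattice_cover (N : lmodType S) :
    lattice rS N -> exists (J : finType) (c : {linear freemod S J -> N}),
  forall n, exists v, c v = n.
Proof.
case=> [J [x [phi [phiL xE]]]]; have [c [cE _]] := free_map x.
exists J, c => n; exists [ffun j => rS (phi j n)].
by rewrite cE [RHS]xE; apply: eq_bigr => j _; rewrite ffunE.
Qed.

End Lattice.

End RLinear.

(* [T] is the tensor product over [R] of [A] and the opposite of [S], where   *)
(* [S] has the dual basis [(td_b, td_f)]; [td_c i] is the map                 *)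
(* [a (x) s |-> a * td_f i s].                                                *)
Record tensor_data (R : comPzRingType) (A S T : pzRingType)
    (rA : {rmorphism R -> A})
    (rS : {rmorphism R -> S}) := TensorData {
  td_rAC : forall r a, rA r * a = a * rA r;
  td_rSC : forall r s, rS r * s = s * rS r;
  td_l : {rmorphism A -> T};
  td_r : S -> T;
  td_rD : {morph td_r : x y / x + y};
  td_r1 : td_r 1 = 1;
  td_rM : forall x y, td_r (x * y) = td_r y * td_r x;
  td_C : forall a s, td_l a * td_r s = td_r s * td_l a;
  td_R : forall r, td_l (rA r) = td_r (rS r);
  td_I : finType;
  td_b : td_I -> S;
  td_f : td_I -> S^o -> R^o;
  td_fL : forall i, rlinear idfun rS (td_f i);
  td_bE : forall s, s = \sum_i rS (td_f i s) * td_b i;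
  td_c : td_I -> T -> A;
  td_cD : forall i, {morph td_c i : x y / x + y};
  td_cE : forall i a s, td_c i (td_l a * td_r s) = a * rA (td_f i s);
  td_sum : forall t, t = \sum_i td_l (td_c i t) * td_r (td_b i)
}.

Arguments td_b {R A S T rA rS} _ i.
Arguments td_f {R A S T rA rS} _ i _.
Arguments td_c {R A S T rA rS} _ i _.
Arguments td_fL {R A S T rA rS} _ i.
Arguments td_cD {R A S T rA rS} _ i.
Arguments td_cE {R A S T rA rS} _ i.

(** * The T-module Hom_R(N, Y): action, exactness, injectivity *)

Definition rhom (R : comPzRingType) (A S T : pzRingType)
    (rA : {rmorphism R -> A})
    (rS : {rmorphism R -> S}) (d : tensor_data T rA rS)
    (N : lmodType S) (Y : lmodType A) : Type :=
  {f : N -> Y | rlinear rA rS f}.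

Section Hom.
Variables (R : comPzRingType) (A S T : pzRingType) (rA : {rmorphism R -> A})
    (rS : {rmorphism R -> S}).
Variable d : tensor_data T rA rS.

Section Module.
Variables (N : lmodType S) (Y : lmodType A).
Local Notation H := (rhom d N Y).

HB.instance Definition _ := gen_eqMixin H.
HB.instance Definition _ := gen_choiceMixin H.

Lemma hom_eq (f g : H) : sval f =1 sval g -> f = g.
Proof. by case: f g => [f fL] [g gL] /= /funext fg; apply: eq_exist. Qed.

Fact hom0_subproof : rlinear rA rS (fun _ : N => 0 : Y).
Proof. by move=> r x y; rewrite scaler0 addr0. Qed.
Fact hom_add_subproof (f g : H) : rlinear rA rS (fun n => sval f n + sval g n).
Proof. by move=> r x y; rewrite (svalP f) (svalP g) scalerDr addrACA. Qed.
Fact hom_opp_subproof (f : H) : rlinear rA rS (fun n => - sval f n).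
Proof. by move=> r x y; rewrite (svalP f) opprD scalerN. Qed.

Definition hom0 : H := exist _ _ hom0_subproof.
Definition hom_add (f g : H) : H := exist _ _ (hom_add_subproof f g).
Definition hom_opp (f : H) : H := exist _ _ (hom_opp_subproof f).

Fact hom_addA : associative hom_add.
Proof. by move=> f g h; apply: hom_eq => n; apply: addrA. Qed.
Fact hom_addC : commutative hom_add.
Proof. by move=> f g; apply: hom_eq => n; apply: addrC. Qed.
Fact hom_add0 : left_id hom0 hom_add.
Proof. by move=> f; apply: hom_eq => n; apply: add0r. Qed.
Fact hom_addN : left_inverse hom0 hom_opp hom_add.
Proof. by move=> f; apply: hom_eq => n; apply: addNr. Qed.
HB.instance Definition _ := GRing.isZmodule.Build H
  hom_addA hom_addC hom_add0 hom_addN.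

Fact hom_scale_subproof (t : T) (f : H) :
  rlinear rA rS (fun n => \sum_i td_c d i t *: sval f (td_b d i *: n)).
Proof.
move=> r x y; rewrite scaler_sumr -big_split; apply: eq_bigr => i _ /=.
rewrite scalerDr scalerA -(td_rSC d) -scalerA (svalP f) scalerDr !scalerA.
by rewrite (td_rAC d).
Qed.
(** The action of a (x) s sends f to n |-> a f(s n). For arbitrary [t] it is written in the
    coordinates [td_c]; [hom_scaleE] recovers the formula on pure tensors. *)
Definition hom_scale (t : T) (f : H) : H := exist _ _ (hom_scale_subproof t f).

Lemma hom_scaleE a s (f : H) n :
  sval (hom_scale (td_l d a * td_r d s) f) n = a *: sval f (s *: n).
Proof.
rewrite [s in RHS](td_bE d) scaler_suml (rlinear_sum (svalP f)) scaler_sumr /=.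
apply: eq_bigr => i _; rewrite td_cE -scalerA; congr (_ *: _).
by rewrite -scalerA (rlinearZ (svalP f)).
Qed.

Fact hom_scaleDl f : {morph hom_scale^~ f : t u / t + u}.
Proof.
move=> t u; apply: hom_eq => n /=; rewrite -big_split; apply: eq_bigr => i _ /=.
by rewrite td_cD scalerDl.
Qed.

Lemma hom_scale_sum (I : finType) (F : I -> T) f n :
  sval (hom_scale (\sum_i F i) f) n = \sum_i sval (hom_scale (F i) f) n.
Proof.
have s0 : hom_scale 0 f = 0.
  by apply: (addrI (hom_scale 0 f)); rewrite -hom_scaleDl !addr0.
by apply: (big_morph (fun t => sval (hom_scale t f) n)) => [t u|];
  rewrite ?hom_scaleDl ?s0.
Qed.

Fact hom_scaleA t u f : hom_scale t (hom_scale u f) = hom_scale (t * u) f.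
Proof.
apply: hom_eq => n; rewrite [t in RHS](td_sum d) [u in RHS](td_sum d) mulr_suml.
rewrite hom_scale_sum; apply: eq_bigr => i _; rewrite mulr_sumr hom_scale_sum.
rewrite scaler_sumr; apply: eq_bigr => j _.
(* [td_r] reverses products, which matches the order in which two successive actions multiply the
   argument. *)
rewrite [in RHS]mulrA -[X in X * _]mulrA -(td_C d) mulrA -rmorphM -mulrA -td_rM.
by rewrite hom_scaleE !scalerA.
Qed.

Fact hom_scale1 : left_id 1 hom_scale.
Proof.
move=> f; apply: hom_eq => n.
have -> : 1 = td_l d 1 * td_r d 1 by rewrite rmorph1 td_r1 mulr1.
by rewrite hom_scaleE !scale1r.
Qed.

Fact hom_scaleDr : right_distributive hom_scale +%R.
Proof.
move=> t f g; apply: hom_eq => n /=; rewrite -big_split;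
  apply: eq_bigr => i _ /=.
by rewrite scalerDr.
Qed.

HB.instance Definition _ := GRing.Zmodule_isLmodule.Build T H
  hom_scaleA hom_scale1 hom_scaleDr hom_scaleDl.

Lemma homD (f g : H) n : sval (f + g) n = sval f n + sval g n.
Proof. by []. Qed.
Lemma homZ t (f : H) n :
  sval (t *: f) n = \sum_i td_c d i t *: sval f (td_b d i *: n).
Proof. by []. Qed.
Lemma homZl a (f : H) n : sval (td_l d a *: f) n = a *: sval f n.
Proof. by rewrite -[td_l d a]mulr1 -(td_r1 d) [LHS]hom_scaleE scale1r. Qed.
Lemma homZr s (f : H) n : sval (td_r d s *: f) n = sval f (s *: n).
Proof. by rewrite -[td_r d s]mul1r -(rmorph1
  (td_l d)) [LHS]hom_scaleE scale1r. Qed.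

End Module.

Section Functor.
Variables (N N' : lmodType S) (Y Y' : lmodType A).
Variables (u : {linear N' -> N}) (v : {linear Y -> Y'}).

Fact hom_pre_subproof (f : rhom d N Y) : rlinear rA rS (fun n => sval f (u n)).
Proof. by move=> r x y; rewrite linearP (svalP f). Qed.
Definition hom_pre_fun (f : rhom d N Y) : rhom d N' Y :=
  exist _ _ (hom_pre_subproof f).
Fact hom_pre_linear : linear hom_pre_fun.
Proof.
move=> t f g; apply: hom_eq => n; rewrite /= ; congr (_ + _).
by apply: eq_bigr => i _; rewrite linearZ.
Qed.
Definition hom_pre : {linear rhom d N Y -> rhom d N' Y} := mklin hom_pre_linear.

Fact hom_post_subproof (f : rhom d N Y) : rlinear rA rS (fun n => v (sval f n)).
Proof. by move=> r x y; rewrite (svalP f) linearP. Qed.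
Definition hom_post_fun (f : rhom d N Y) : rhom d N Y' :=
  exist _ _ (hom_post_subproof f).
Fact hom_post_linear : linear hom_post_fun.
Proof.
move=> t f g; apply: hom_eq => n /=; rewrite linearD linear_sum; congr (_ + _).
by apply: eq_bigr => i _; rewrite linearZ.
Qed.
Definition hom_post : {linear rhom d N Y ->
    rhom d N Y'} := mklin hom_post_linear.

End Functor.

(** [N] is projective over R: a map into [Z] is lifted by lifting its values on the vectors of a
    dual basis. *)
Lemma hom_post_ses (N : lmodType S) (X Y Z : lmodType A)
    (i : {linear X -> Y}) (p : {linear Y -> Z}) :
  lattice rS N -> ses i p -> ses (hom_post N i) (hom_post N p).
Proof.
move=> [J [x [phi [phiL xE]]]] [iI ps ipE]; split.
- by move=> f g fg; apply: hom_eq => n; apply: iI;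
  have /(congr1 (fun h => sval h n)) := fg.
- move=> f; have /choice[y yE] j := ps (sval f (x j)).
  have gL : rlinear rA rS (fun n => \sum_j rA (phi j n) *: y j).
    move=> r m n; rewrite scaler_sumr -big_split; apply: eq_bigr => j _ /=.
    by rewrite phiL rmorphD scalerDl rmorphM scalerA.
  exists (exist _ _ gL); apply: hom_eq => n /=.
  rewrite [n in RHS]xE (rlinear_sum (svalP f)) linear_sum;
    apply: eq_bigr => j _.
  by rewrite linearZ yE (rlinearZ (svalP f)).
- move=> g; split=> [pg|[f ->]]; last first.
    by apply: hom_eq => n /=; apply/ipE; exists (sval f n).
  have /choice[f fE] n : exists y, sval g n = i y.
    by apply/ipE; have /(congr1 (fun h => sval h n)) := pg.
  have fL : rlinear rA rS f.
    by move=> r m n; apply: iI; rewrite linearP -!fE (svalP g).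
  by exists (exist _ f fL); apply: hom_eq.
Qed.

(** The sequence splits over R because [N] is a lattice, so maps on [K] extend to [F] through
    [rho]. *)
Lemma hom_pre_ses (Y : lmodType A) (K F N : lmodType S)
    (i : {linear K -> F}) (p : {linear F -> N}) :
  lattice rS N -> ses i p -> ses (hom_pre Y p) (hom_pre Y i).
Proof.
move=> NL ip; have [rho rhoL rhoK] := lattice_retract ip NL.
have [iI ps ipE] := ip; split.
- move=> f g fg; apply: hom_eq => n; have [y <-] := ps n.
  by have /(congr1 (fun h => sval h y)) := fg.
- move=> f; have gL : rlinear rA rS (fun v => sval f (rho v)).
    by move=> r u v; rewrite rhoL (svalP f).
  by exists (exist _ _ gL); apply: hom_eq => k /=; rewrite rhoK.
- move=> g; split=> [gi|[f ->]]; last first.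
    by apply: hom_eq => k /=; rewrite (ses_comp0 k ip) (rlinear0 (svalP f)).
  have gE v w : p v = p w -> sval g v = sval g w.
    move=> vw; have /ipE[k kE] : p (v - w) = 0 by rewrite linearB vw subrr.
    rewrite -(subrK w v) kE (rlinearD (svalP g)).
    by have /(congr1 (fun h => sval h k)) /= -> := gi; rewrite add0r.
  have [q qE] := choice ps.
  have fL : rlinear rA rS (fun n => sval g (q n)).
    by move=> r m n; rewrite -(svalP g); apply: gE; rewrite linearP !qE.
  by exists (exist _ _ fL); apply: hom_eq => v /=; apply: gE; rewrite qE.
Qed.

(* Hom_T(X, rhom (freemod S J) Y) is a product of copies of Hom_A(X, Y). *)
Lemma hom_free_ext (J : finType) (Y : lmodType A) (X Z : lmodType T)
    (i : {linear X -> Z}) :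
    (forall g : {linear restr (td_l d) X -> Y},
      exists h : {linear restr (td_l d) Z -> Y}, forall x, h (i x) = g x) ->
  forall g : {linear X -> rhom d (freemod S J) Y},
    exists h : {linear Z -> rhom d (freemod S J) Y}, forall x, h (i x) = g x.
Proof.
move=> ext g.
have gL j : linear (fun x : restr (td_l d) X => sval (g x) (basis S j)).
  by move=> a x y; rewrite linearD [a *: x]restrZ linearZ homD homZl.
have /choice[h hE] j := ext (mklin (gL j)).
have hZ j a (z : restr (td_l d) Z) : h j
  (a *: z) = a *: h j z by rewrite linearZ.
(* The map rebuilt from its components on the basis: the entries of [v] have to act on [z] through
   [td_r]. *)
pose k (z : Z) (v : freemod S J) := \sum_j h j (td_r d (v j) *: z).
have kL z : rlinear rA rS (k z).
  move=> r v w; rewrite /k scaler_sumr -big_split; apply: eq_bigr => j _ /=.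
  rewrite !ffunE td_rD scalerDl linearD td_rM -td_R -td_C -scalerA;
    congr (_ + _).
  exact: hZ.
pose K z : rhom d (freemod S J) Y := exist _ _ (kL z).
have KL : linear K.
  move=> t z w; apply: hom_eq => v; rewrite homD homZ /= /k.
  under [in RHS]eq_bigr do rewrite scaler_sumr.
  rewrite exchange_big -big_split; apply: eq_bigr => j _ /=.
  rewrite scalerDr [LHS]linearD; congr (_ + _).
  rewrite [t in LHS](td_sum d) scaler_suml scaler_sumr linear_sum.
  apply: eq_bigr => l _; rewrite ffunE.
  rewrite scalerA mulrA -td_C -mulrA -td_rM -scalerA.
  exact: hZ.
exists (mklin KL) => x; apply: hom_eq => v /=; rewrite /k.
rewrite [v in RHS]free_sum (rlinear_sum (svalP (g x))); apply: eq_bigr => j _.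
by rewrite -linearZ hE /= linearZ homZr.
Qed.

(** [K] is a direct summand of a free module, so an extension into Hom_R(free, Y), available since
    [Y] is injective over [A], can be restricted along [s]. *)
Lemma hom_injective (J : finType) (K : lmodType S) (Y : lmodType A)
    (p : {linear freemod S J -> K}) (s : {linear K -> freemod S J}) :
  (forall k, p (s k) = k) -> injective_module Y -> injective_module
    (rhom d K Y).
Proof.
move=> ps YI X Z i g iI.
have [|h hE] := @hom_free_ext J Y X Z i _ (hom_pre Y p \o g).
  move=> g'; have iL : linear (i : restr (td_l d) X -> restr (td_l d) Z).
    by move=> a x y; rewrite [a *: x]restrZ linearD linearZ.
  exact: (YI _ _ (mklin iL)).
exists (hom_pre Y s \o h) => x; rewrite /= hE; apply: hom_eq => k /=.
by rewrite ps.
Qed.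

(** Hom_R(K, -) is exact and preserves injectives, so it carries each step of an injective
    coresolution of [Y] to one of Hom_R(K, Y). *)
Lemma hom_fid n (J : finType) (K : lmodType S) (Y : lmodType A)
    (p : {linear freemod S J -> K}) (s : {linear K -> freemod S J}) :
  (forall k, p (s k) = k) -> lattice rS K -> fid n Y -> fid n (rhom d K Y).
Proof.
move=> ps KL; elim: n Y => [|n IHn] Y; first exact: hom_injective.
case=> I [Y' [i [q [II iq /IHn Y'n]]]].
exists (rhom d K I), (rhom d K Y'), (hom_post K i), (hom_post K q); split=> //.
  exact: hom_injective ps II.
exact: hom_post_ses.
Qed.

Lemma lattice_scalar : lattice rS (S^o : lmodType S).
Proof. by exists (td_I d), (td_b d), (td_f d); split;
  [exact: td_fL|exact: td_bE]. Qed.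

End Hom.

(** * Duality over R *)

Section Duality.
Variables (R : comPzRingType) (S T : pzRingType) (rS : {rmorphism R -> S}).
Variable d : tensor_data T (idfun : {rmorphism R -> R}) rS.
Local Notation dual N := (rhom d N (R^o : lmodType R)).

Lemma dual_expand (N : lmodType S) (J : finType) (x : J -> N)
    (phi : J -> dual N) :
    (forall n, n = \sum_j rS (sval (phi j) n) *: x j) ->
  forall f : dual N, f = \sum_j td_l d (sval f (x j)) *: phi j.
Proof.
move=> xE f; apply: hom_eq => n.
have sE (F : J -> dual N) : sval (\sum_j F j) n = \sum_j sval (F j) n.
  by apply: (big_morph (fun f : dual N => sval f n)).
rewrite sE [n in LHS]xE (rlinear_sum (svalP f)); apply: eq_bigr => j _.
by rewrite homZl (rlinearZ (svalP f)) /= [LHS]mulrC.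
Qed.

Lemma lattice_dualE (N : lmodType S) :
  lattice rS N -> exists (J : finType) (x : J -> N) (phi : J -> dual N),
    forall n, n = \sum_j rS (sval (phi j) n) *: x j.
Proof.
case=> J [x [phi [phiL xE]]].
by exists J, x, (fun j => exist _ (phi j) (phiL j)).
Qed.

(** A dual basis of [N] with its two halves exchanged: the vectors become evaluation functionals. *)
Lemma lattice_dual (N : lmodType S) : lattice rS N -> lattice (td_l d) (dual N).
Proof.
case/lattice_dualE=> J [x [phi xE]]; exists J, phi, (fun j f => sval f (x j)).
split=> [j r f g|f]; first by rewrite homD homZl.
exact: dual_expand.
Qed.

(** The section is the transpose of [r] under the bidualities of [F] and [K], written out in dual
    bases; transposing the hypothesis on [r] gives c s = id. *)
Lemma dual_section (F K : lmodType S) (c : {linear F -> K})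
    (r : {linear dual F -> dual K}) :
    lattice rS F -> lattice rS K -> (forall f, r (hom_pre d R^o c f) = f) ->
  exists s : {linear K -> F}, forall k, c (s k) = k.
Proof.
move=> /lattice_dualE[J [x [phi xE]]] /lattice_dualE[I [y [psi yE]]] rK.
have rE f k : sval (r f) k = \sum_j sval f (x j) * sval (r (phi j)) k.
  rewrite [f in LHS](dual_expand xE) linear_sum.
  rewrite (big_morph (fun f : dual K => sval f k) (id1 := 0) (op1 := +%R)) //.
  by apply: eq_bigr => j _; rewrite linearZ homZl.
pose s k := \sum_j rS (sval (r (phi j)) k) *: x j.
have sL : linear s.
  move=> a k l; rewrite /s scaler_sumr.
  (* Linearity of [r] moves [a] from [k] to the functionals [phi j], hence onto the vectors; the
     dual basis identity then reassembles a times each vector. *)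
  have -> : \sum_j a *: (rS (sval (r (phi j)) k) *: x j) =
      \sum_j rS (sval (r (phi j)) (a *: k)) *: x j.
    under [RHS]eq_bigr => j _.
      rewrite -homZr -linearZ rE rmorph_sum scaler_suml; over.
    rewrite exchange_big; apply: eq_bigr => i _.
    under eq_bigr do rewrite rmorphM (td_rSC d) -scalerA homZr.
    by rewrite -scaler_sumr -xE !scalerA (td_rSC d).
  rewrite -big_split; apply: eq_bigr => j _ /=.
  by rewrite (rlinearD (svalP _)) rmorphD scalerDl.
exists (mklin sL) => k; rewrite [LHS]yE [RHS]yE; apply: eq_bigr => i _.
congr (rS _ *: _); rewrite -[in RHS](rK (psi i)) rE /= linear_sum.
rewrite (rlinear_sum (svalP (psi i))); apply: eq_bigr => j _.
by rewrite linearZ (rlinearZ (svalP (psi i))) /= [LHS]mulrC.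
Qed.

End Duality.

(** * Opposite algebras and presentations of tensor products *)

Section OppositeMap.
Variables (R : comPzRingType) (B : pzRingType) (rB : {rmorphism R -> B}).
Hypothesis rBC : forall r b, rB r * b = b * rB r.

Definition op_fun : R -> B^c := rB.

Fact op_fun_zmod : zmod_morphism op_fun.
Proof. by move=> x y; apply: (rmorphB rB). Qed.
Fact op_fun_monoid : monoid_morphism op_fun.
Proof.
split=> [|x y]; first exact: (rmorph1 rB).
by rewrite /op_fun [LHS](rmorphM rB); apply: rBC.
Qed.

Definition op_map : {rmorphism R -> B^c} :=
  HB.pack op_fun (GRing.isZmodMorphism.Build _ _ op_fun op_fun_zmod)
    (GRing.isMonoidMorphism.Build _ _ op_fun op_fun_monoid).

End OppositeMap.

(* [T] is the tensor product of [A] and [B] over [R]. Unlike [tensor_data],   *)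
(* this is invariant under passage to the opposite rings.                     *)
Record tensor_decomp (R : comPzRingType) (A B T : pzRingType)
    (rA : {rmorphism R -> A}) (rB : {rmorphism R -> B}) := TensorDecomp {
  ts_rAC : forall r a, rA r * a = a * rA r;
  ts_rBC : forall r b, rB r * b = b * rB r;
  ts_l : {rmorphism A -> T};
  ts_r : {rmorphism B -> T};
  ts_C : forall a b, ts_l a * ts_r b = ts_r b * ts_l a;
  ts_R : forall r, ts_l (rA r) = ts_r (rB r);
  ts_I : finType;
  ts_b : ts_I -> B;
  ts_f : ts_I -> B^o -> R^o;
  ts_fL : forall i, rlinear idfun rB (ts_f i);
  ts_bE : forall b, b = \sum_i rB (ts_f i b) * ts_b i;
  ts_c : ts_I -> T -> A;
  ts_cD : forall i, {morph ts_c i : x y / x + y};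
  ts_cE : forall i a b, ts_c i (ts_l a * ts_r b) = a * rA (ts_f i b);
  ts_sum : forall t, t = \sum_i ts_l (ts_c i t) * ts_r (ts_b i)
}.
Arguments ts_b {R A B T rA rB} _ i.
Arguments ts_f {R A B T rA rB} _ i _.
Arguments ts_c {R A B T rA rB} _ i _.
Arguments ts_fL {R A B T rA rB} _ i.
Arguments ts_cD {R A B T rA rB} _ i.
Arguments ts_cE {R A B T rA rB} _ i.

(** * Injective dimension of a tensor product *)

Section Core.
Variables (R : comPzRingType) (A B T : pzRingType).
Variables (rA : {rmorphism R -> A}) (rB : {rmorphism R -> B}).
Variable D : tensor_decomp T rA rB.

Let S : pzRingType := B^c.
Let rS : {rmorphism R -> S} := op_map (ts_rBC D).
Let rR : {rmorphism R -> R} := idfun.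

Fact decomp_fLc i : rlinear idfun rS (ts_f D i : S^o -> R^o).
Proof.
move=> r x y; rewrite -(ts_fL D i); congr (ts_f D i (_ + _)).
exact: esym (ts_rBC D r x).
Qed.

Fact decomp_bEc (b : S) : b = \sum_i rS (ts_f D i b) * ts_b D i.
Proof.
by rewrite {1}[b](ts_bE D); apply: eq_bigr => i _; apply: (ts_rBC D).
Qed.

(** This instance makes Hom_R(right B-module, left A-module) a T-module. The next two, with R in
    place of [A], turn duals of right B-modules into left ones and conversely. *)
Definition decomp_data : tensor_data T rA rS :=
  @TensorData R A S T rA rS (ts_rAC D) (fun r b => esym (ts_rBC D r b))
    (ts_l D) (ts_r D) (rmorphD (ts_r D)) (rmorph1 (ts_r D))
    (fun x y => rmorphM (ts_r D) y x) (ts_C D) (ts_R D) (ts_I D) (ts_b D)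
    (ts_f D) decomp_fLc decomp_bEc (ts_c D) (ts_cD D) (ts_cE D) (ts_sum D).

Definition right_dual_data : tensor_data B rR rS :=
  @TensorData R R S B rR rS (@mulrC R) (fun r b => esym (ts_rBC D r b))
    rB id (fun x y => erefl) erefl (fun x y => erefl) (ts_rBC D)
      (fun r => erefl)
    (ts_I D) (ts_b D) (ts_f D) decomp_fLc decomp_bEc (ts_f D)
    (fun i => rlinearD (ts_fL D i)) (fun i => rlinearZ (ts_fL D i)) (ts_bE D).

Definition left_dual_data : tensor_data S rR rB :=
  @TensorData R R B S rR rB (@mulrC R) (ts_rBC D)
    rS id (fun x y => erefl) erefl (fun x y => erefl)
    (fun r b => esym (ts_rBC D r b)) (fun r => erefl)
    (ts_I D) (ts_b D) (ts_f D) (ts_fL D) (ts_bE D) (ts_f D)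
    (fun i => rlinearD (ts_fL D i)) (fun i => rlinearZ
      (decomp_fLc i)) decomp_bEc.

Local Notation dR K := (rhom right_dual_data K (R^o : lmodType R)).
Let DB : lmodType S :=
  rhom left_dual_data (B^o : lmodType B) (R^o : lmodType R).

(** Dimension shift in the direction opposite to [extv_shift]. The middle term is the dual of a free
    module, hence injective relative to R-split inclusions; the syzygies of a lattice give such
    inclusions. *)
Lemma extv_shift_dual n (J : finType) (M Y Y' : lmodType B)
    (a : {linear Y -> dR (freemod S J)}) (b : {linear dR (freemod S J) -> Y'}) :
  ses a b -> lattice rB M -> extv n.+1 M Y -> extv n M Y'.
Proof.
move=> ab; have [aI bs abE] := ab.
have BL : lattice rB (B^o : lmodType B) by exact:
  (lattice_scalar left_dual_data).
elim: n M => [|n IHn] M ML MY J0 K i p ip; last first.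
  apply: IHn (MY _ _ _ _ ip); exact: lattice_ker ip ML (lattice_free _ BL).
move=> g; have KL := lattice_ker ip ML (lattice_free _ BL).
have [J1 [c cs]] := lattice_cover KL.
have cK := ses_ker cs; have [_ _ cKE] := cK.
have [l lE] := free_lift (g \o c) bs.
have [|m mE] := @linear_lift _ _ _ _ a (l \o ker_val c) aI.
  by move=> x; apply/abE; rewrite /= lE /= (ses_comp0 x cK) linear0.
have [h1 h1E] := MY _ _ _ _ ip _ _ _ _ cK m.
have [|g' g'E] := @linear_factor _ _ _ _ c (l \- (a \o h1)) cs.
  by move=> _ /cKE[x ->]; rewrite /= h1E -mE subrr.
have [iI _ _] := ip; have [rho rhoL rhoK] := lattice_retract ip ML.
(* Maps into the dual of a free module extend as soon as R-linear maps into R do, and these extend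
   by composition with [rho]. *)
have [|k kE] := @hom_free_ext _ _ _ _ _ _ right_dual_data J R^o _ _ i _ g'.
  move=> e; have eL : linear (fun z : restr rB (freemod B J0) => e (rho z)).
    move=> r u v; rewrite [r *: u]restrZ [LHS](congr1 e (rhoL r u v)).
    exact: (linearP e r (rho u)).
  by exists (mklin eL) => x /=; rewrite rhoK.
exists (b \o k) => x; have [v <-] := cs x.
by rewrite /= kE g'E /= linearB lE (ses_comp0 _ ab) subr0.
Qed.

(** Induction along the syzygies of [K]: each one lowers n by one through [extv_shift_dual], and at
    n = 0 the syzygy reached is projective. *)
Lemma hom_finite n m (K : lmodType S) (Y : lmodType A) :
    lattice rS K -> (forall M, lattice rB M -> extv n M (dR K)) -> fid m Y ->
  exists l, fid l (rhom decomp_data K Y).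
Proof.
have SL : lattice rS (S^o : lmodType S) by exact:
  (lattice_scalar right_dual_data).
elim: n K => [|n IHn] K KL KE Ym; have [J [c cs]] := lattice_cover KL;
  have cK := ses_ker cs; have FL := lattice_free J SL;
  have K'L := lattice_ker cK KL FL.
  (* The hypothesis is applied to the dual of the next syzygy: it splits the dualized sequence, and
     dualizing back makes [K] a direct summand of a free module. *)
  have [I [e es]] := lattice_cover (lattice_dual right_dual_data K'L).
  have [r rE] := extv0_split (hom_pre_ses right_dual_data R^o KL cK) es
    (KE _ (lattice_dual right_dual_data K'L)).
  have [s sE] := dual_section FL KL rE.
  by exists m; apply: hom_fid sE KL Ym.
have [|l K'l] := IHn _ K'L _ Ym.
  move=> M ML.
  exact: extv_shift_dual (hom_pre_ses right_dual_data R^o KL cK) ML (KE M ML).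
have Fm : fid m (rhom decomp_data (freemod S J) Y).
  exact: (@hom_fid _ _ _ _ _ _ decomp_data m J _ Y idfun idfun).
(* [fid_ker] requires one common bound for the two right-hand terms and loses one degree. *)
exists (maxn m l).+1; apply: fid_ker (hom_pre_ses decomp_data Y KL cK) _ _.
  exact: fid_leq (leq_maxl _ _) Fm.
exact: fid_leq (leq_maxr _ _) K'l.
Qed.

Section Biduality.
Variables (A' T' : pzRingType) (rA' : {rmorphism R -> A'}).
Variable d : tensor_data T' rA' rS.

(** The contraction sending a (x) s to a phi(s), in coordinates. The section is generic in [A']:
    taking [A] identifies [T] with Hom_R(DB, A), and taking R identifies [B] with the dual of
    [DB]. *)
Definition bidual_val (t : T') (phi : DB) : A'^o :=
  \sum_i td_c d i t * rA' (sval phi (td_b d i)).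

Lemma DBD (phi psi : DB) (x : B) : sval (phi + psi) x = sval phi x + sval psi x.
Proof. by []. Qed.

Lemma DBZ (b : S) (phi : DB) (x : B) : sval (b *: phi) x = sval phi ((b :
    B) * x).
Proof. exact: (homZr (d := left_dual_data) b phi x). Qed.

Lemma DBZr r (phi : DB) (x : B) : sval (rS r *: phi) x = r * sval phi x.
Proof. exact: (homZl (d := left_dual_data) r phi x). Qed.

Lemma DB_rlinear (phi : DB) : rlinear idfun rS (sval phi : S^o -> R^o).
Proof.
move=> r x y; rewrite -(svalP phi); congr (sval phi (_ + _)).
exact: esym (ts_rBC D r x).
Qed.

Fact bidual_subproof t : rlinear rA' rS (bidual_val t).
Proof.
move=> r f g; rewrite /bidual_val scaler_sumr -big_split; apply: eq_bigr => i _.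
rewrite DBD DBZr rmorphD rmorphM mulrDr; congr (_ + _).
by rewrite mulrA -(td_rAC d r) -mulrA.
Qed.

Definition bidual_fun (t : T'^o) : rhom d DB (A'^o : lmodType A') :=
  exist _ _ (bidual_subproof t).

Lemma bidual_funD : {morph bidual_fun : x y / x + y}.
Proof.
move=> t u; apply: hom_eq => phi; rewrite homD /= /bidual_val -big_split.
by apply: eq_bigr => i _; rewrite td_cD mulrDl.
Qed.

Lemma bidual_fun_sum (I : finType) (F : I -> T') phi :
  sval (bidual_fun (\sum_i F i)) phi = \sum_i sval (bidual_fun (F i)) phi.
Proof.
apply: (big_morph (fun t => sval (bidual_fun t) phi)) => [t u|].
  by rewrite bidual_funD homD.
suff -> : bidual_fun 0 = 0 by [].
by apply: (addrI (bidual_fun 0)); rewrite -bidual_funD !addr0.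
Qed.

Lemma bidual_funE a s phi :
  sval (bidual_fun (td_l d a * td_r d s)) phi = a * rA' (sval phi s).
Proof.
rewrite [s in RHS](td_bE d) (rlinear_sum (DB_rlinear phi)) rmorph_sum mulr_sumr.
apply: eq_bigr => i _; rewrite td_cE -mulrA -rmorphM; congr (_ * rA' _).
exact: esym (rlinearZ (DB_rlinear phi) _ _).
Qed.

Fact bidual_linear : linear bidual_fun.
Proof.
move=> t u v; rewrite bidual_funD; congr (_ + _).
apply: hom_eq => phi; rewrite homZ.
(* The product of basis elements is taken in [S], so in [B] it is the product in the other order,
   which is what acting on [phi] and then evaluating gives. *)
rewrite (_ : t *: u = \sum_i \sum_j td_l d (td_c d i t * td_c d j u) *
                                    td_r d (td_b d j * td_b d i)).
  rewrite bidual_fun_sum; apply: eq_bigr => i _; rewrite bidual_fun_sum.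
  rewrite scaler_sumr; apply: eq_bigr => j _; rewrite bidual_funE DBZ.
  exact: esym (mulrA _ _ _).
rewrite -[LHS]/(t * u) {1}(td_sum d t) {1}(td_sum d u) mulr_suml.
apply: eq_bigr => i _; rewrite mulr_sumr; apply: eq_bigr => j _.
by rewrite rmorphM td_rM !mulrA; congr (_ * _); rewrite -!mulrA td_C.
Qed.

Definition bidual : {linear T'^o -> rhom d DB (A'^o : lmodType A')} :=
  mklin bidual_linear.

Fact dual_basis_subproof i : rlinear idfun rB (td_f d i : B^o -> R^o).
Proof.
move=> r x y; rewrite -(td_fL d i); congr (td_f d i (_ + _)).
exact: (ts_rBC D r x).
Qed.
Definition dual_basis i : DB := exist _ _ (dual_basis_subproof i).

Lemma dual_basisE (phi : DB) :
  phi = \sum_i rS (sval phi (td_b d i)) *: dual_basis i.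
Proof.
apply: hom_eq => x.
rewrite (big_morph (fun f : DB => sval f x) (id1 := 0) (op1 := +%R)) //.
rewrite [x in LHS](td_bE d) (rlinear_sum (DB_rlinear phi));
  apply: eq_bigr => i _.
by rewrite DBZr mulrC; apply: (rlinearZ (DB_rlinear phi)).
Qed.

(** The coordinate functionals generate [DB] over R, so a map on [DB] is determined by its values
    there; these values are the coordinates of the preimage. *)
Lemma bidual_bij : bijective bidual.
Proof.
exists (fun F => \sum_i td_l d (sval F (dual_basis i)) * td_r d (td_b d i)).
  move=> t; rewrite [RHS](td_sum d) /= /bidual_val.
  under eq_bigr do rewrite rmorph_sum mulr_suml.
  rewrite exchange_big; apply: eq_bigr => i _.
  rewrite [td_b d i in RHS](td_bE d).
  rewrite (big_morph (td_r d) (id1 := 0) (op1 := +%R) (@td_rD _ _ _ _ _ _ d));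
    last first.
    by apply: (addrI (td_r d 0)); rewrite -td_rD !addr0.
  rewrite mulr_sumr; apply: eq_bigr => j _.
  by rewrite rmorphM td_rM -td_R -td_C mulrA.
move=> F; apply: (@hom_eq _ _ _ _ _ _ d DB A'^o) => phi.
rewrite [LHS]bidual_fun_sum.
rewrite [phi in RHS]dual_basisE (rlinear_sum (svalP F)); apply: eq_bigr => i _.
by rewrite bidual_funE (rlinearZ (svalP F)) [RHS](td_rAC d).
Qed.

End Biduality.

Theorem tensor_injdim :
    finite_injdim (A^o : lmodType A) -> finite_injdim (B^o : lmodType B) ->
  finite_injdim (T^o : lmodType T).
Proof.
move=> /finite_injdimE[m Am] /finite_injdimE[n Bn]; apply/finite_injdimE.
have DBL : lattice rS DB.
  exact: (lattice_dual left_dual_data (lattice_scalar left_dual_data)).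
(* The dual of [DB] is [B], so the Ext vanishing required by [hom_finite] for K = DB follows from
   the injective dimension of [B]. *)
have [g gK g'K] := bidual_bij right_dual_data.
have gL : linear g.
  by move=> b x y; apply: (can_inj gK); rewrite linearP !g'K.
have gB : bijective (mklin gL) by exists (bidual right_dual_data).
have [M _|l Al] := @hom_finite n m DB A^o DBL _ Am.
  exact/fid_extv/(fid_iso gB).
by exists l; apply: fid_iso (bidual_bij decomp_data) Al.
Qed.

End Core.

(** * Passage to the opposite rings *)

Section Opposite.
Variables (A T : pzRingType) (f : {rmorphism A -> T}).

Definition op_rfun : A^c -> T^c := f.

Fact op_rfun_zmod : zmod_morphism op_rfun.
Proof. by move=> x y; apply: (rmorphB f). Qed.
Fact op_rfun_monoid : monoid_morphism op_rfun.
Proof. by split=> [|x y]; [apply: (rmorph1 f)|apply: (rmorphM f)]. Qed.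

Definition op_rmorph : {rmorphism A^c -> T^c} :=
  HB.pack op_rfun (GRing.isZmodMorphism.Build _ _ op_rfun op_rfun_zmod)
    (GRing.isMonoidMorphism.Build _ _ op_rfun op_rfun_monoid).

End Opposite.

Section OppositeDecomp.
Variables (R : comPzRingType) (A B T : pzRingType).
Variables (rA : {rmorphism R -> A}) (rB : {rmorphism R -> B}).
Variable D : tensor_decomp T rA rB.

Fact op_cE i a b :
  ts_c D i (ts_r D b * ts_l D a) = rA (ts_f D i b) * a.
Proof. by rewrite -(ts_C D) ts_cE (ts_rAC D). Qed.

Fact op_sum t : t = \sum_i ts_r D (ts_b D i) * ts_l D (ts_c D i t).
Proof. by rewrite {1}[t](ts_sum D); apply: eq_bigr => i _; rewrite ts_C. Qed.

(** Reduces the injective dimension of [T] on the right to the result on the left. Basis and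
    coordinates are unchanged, since the image of R is central and the two factors commute in
    [T]. *)
Definition op_decomp : tensor_decomp T^c (op_map (ts_rAC D))
    (op_map (ts_rBC D)) :=
  @TensorDecomp R A^c B^c T^c (op_map (ts_rAC D)) (op_map (ts_rBC D))
    (fun r a => esym (ts_rAC D r a)) (fun r b => esym (ts_rBC D r b))
    (op_rmorph (ts_l D)) (op_rmorph (ts_r D)) (fun a b => esym (ts_C D a b))
    (ts_R D) (ts_I D) (ts_b D) (ts_f D) (@decomp_fLc R A B T rA rB D)
      (decomp_bEc D)
    (ts_c D) (ts_cD D) op_cE op_sum.

End OppositeDecomp.

(** * Noetherian modules and rings of fractions *)

Section Noetherian.
Variables (R : pzRingType).

Lemma fg_submoduleP (V : lmodType R) (N : V -> Prop) (J : finType)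
    (e : J -> V) :
    (forall x, N x <-> exists c : J -> R, x = \sum_j c j *: e j) ->
  fg_submodule N.
Proof.
move=> NE; exists #|J|, (e \o enum_val) => x; apply: (iff_trans (NE x)).
split=> -[c ->].
  exists (c \o enum_val); rewrite (reindex (@enum_val J J)) //=.
  exact/onW_bij/enum_val_bij.
exists (c \o enum_rank); rewrite (reindex (@enum_val J J)).
  by apply: eq_bigr => j _; rewrite /= enum_valK.
exact/onW_bij/enum_val_bij.
Qed.

Lemma submodule_sum (V : lmodType R) (N : V -> Prop) (J : finType)
    (c : J -> R) (e : J -> V) :
  submodule N -> (forall j, N (e j)) -> N (\sum_j c j *: e j).
Proof.
move=> NS Ne; apply: big_ind => [|x y|j _]; first by case: NS.
  exact: submD.
exact: submZ.
Qed.

(** Induction on the number of generators. The coefficients of the first generator in elements of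
    [N] form a left ideal; lifts of its generators, together with generators of the part of [N] in
    the span of the others, generate [N]. *)
Lemma noetherian_fg (V : lmodType R) :
  left_noetherian R -> finitely_generated V -> noetherian_module V.
Proof.
move=> Rn [n [e eE]] N NS.
(* Spanning is weakened to the elements of [N], because the induction replaces [N] by a submodule in
   the span of fewer vectors while [V] stays fixed. *)
have {eE} Ne x : N x -> exists c : 'I_n -> R, x = \sum_i c i *: e i.
  by move=> _; apply/eE.
elim: n => [|n IHn] in N NS e Ne *.
  exists 0%N, e => x; split=> [/Ne //|[c ->]].
  by rewrite big_ord0; case: NS.
pose span x := exists c : 'I_n -> R, x = \sum_i c i *: e (lift ord0 i).
have spanB a x y : span x -> span y -> span (a *: x + y).
  move=> [c ->] [c' ->]; exists (fun i => a * c i + c' i).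
  rewrite scaler_sumr -big_split; apply: eq_bigr => i _ /=.
  by rewrite scalerDl scalerA.
have span0 : span 0.
  by exists (fun=> 0); rewrite big1 // => i _; rewrite scale0r.
have spanS : submodule span by split.
pose I (r : R^o) := exists2 y, span y & N ((r : R) *: e ord0 + y).
have IS : submodule I.
  split=> [|a r s [y ys yN] [z zs zN]].
    by exists 0 => //; rewrite scale0r addr0; case: NS.
  exists (a *: y + z); first exact: spanB.
  rewrite scalerDl addrACA -[(a *: r : R) *: _]scalerA -scalerDr.
  by case: NS => _; apply.
have [m [r rE]] := Rn I IS.
have rI j : I (r j).
  apply/rE; exists (fun i => (i == j)%:R); rewrite (bigD1 j) //= eqxx scale1r.
  by rewrite big1 ?addr0 // => i /negPf ->; rewrite scale0r.
have /choice[y yE] j : exists y, span y /\ N ((r j : R) *: e ord0 + y).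
  by case: (rI j) => y ys yN; exists y.
pose N' x := N x /\ span x.
have N'S : submodule N'.
  split=> [|a x z [xN xs] [zN zs]]; first by split=> //; case: NS.
  by split; [case: NS => _; apply|apply: spanB].
have [l [z zE]] := IHn N' N'S (fun i => e (lift ord0 i)) (fun x => @proj2 _ _).
have zN k : N' (z k).
  apply/zE; exists (fun i => (i == k)%:R); rewrite (bigD1 k) //= eqxx scale1r.
  by rewrite big1 ?addr0 // => i /negPf ->; rewrite scale0r.
pose g (j : 'I_m + 'I_l) :=
  match j with inl j => (r j : R) *: e ord0 + y j | inr k => z k end.
have gN j : N (g j) by case: j => [j|k]; [case: (yE j)|case: (zN k)].
apply: (@fg_submoduleP _ _ _ g) => x; split=> [xN|[c ->]];
  last exact: submodule_sum.
have [c cE] := Ne x xN; rewrite big_ord_recl in cE.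
have : I (c ord0).
  by exists (\sum_(i < n) c (lift ord0 i) *: e (lift ord0 i));
    rewrite -?cE //; eexists.
case/rE=> a aE.
pose w := x - \sum_j a j *: ((r j : R) *: e ord0 + y j).
have : N' w.
  split.
    apply: submD => //; apply: (submN NS); apply: submodule_sum => // j.
    by case: (yE j).
  rewrite /w cE.
  have -> : \sum_j a j *: ((r j : R) *: e ord0 + y j) =
      c ord0 *: e ord0 + \sum_j a j *: y j.
    rewrite aE scaler_suml -big_split; apply: eq_bigr => j _ /=.
    by rewrite scalerDr scalerA.
  rewrite opprD addrACA subrr add0r; apply: (submD spanS); first by eexists.
  apply: (submN spanS); apply: submodule_sum => // j; by case: (yE j).
case/zE=> b bE.
exists (fun j => match j with inl j => a j | inr k => b k end).
by rewrite big_sumType /= -bE addrC subrK.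
Qed.

End Noetherian.

(** A submodule of [V] is generated by its contraction to [W]: denominators can be cleared in [V]
    and restored. As [rho] is just a function, the statement covers a localization and its opposite
    alike. *)
Lemma noetherian_fractions (R S : pzRingType) (W : lmodType R) (V : lmodType S)
    (rho : R -> S) (j : W -> V) :
    noetherian_module W -> {morph j : x y / x + y} ->
    (forall r w, j (r *: w) = rho r *: j w) ->
    (forall v, exists w u u', v = u *: j w /\ j w = u' *: v) ->
  noetherian_module V.
Proof.
move=> Wn jD jZ frac_ex N NS.
have j0 : j 0 = 0 by apply: (addrI (j 0)); rewrite -jD !addr0.
have MS : submodule (fun w => N (j w)).
  split=> [|r x y xN yN]; first by rewrite j0; case: NS.
  by rewrite jD jZ; case: NS => _; apply.
have [n [e eE]] := Wn _ MS; exists n, (j \o e) => v.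
have eN i : N (j (e i)).
  apply/eE; exists (fun k => (k == i)%:R); rewrite (bigD1 i) //= eqxx scale1r.
  by rewrite big1 ?addr0 // => k /negPf ->; rewrite scale0r.
split=> [vN|[c ->]]; last exact: submodule_sum.
have [w [u [u' [vE wE]]]] := frac_ex v.
have /eE[c cE] : N (j w) by rewrite wE; apply: submZ.
exists (fun i => u * rho (c i)); rewrite vE cE (big_morph j jD j0) scaler_sumr.
by apply: eq_bigr => i _; rewrite jZ scalerA.
Qed.

(** * Dual bases and projectivity *)

Section DualBasis.
Variables (R : comPzRingType) (P : lmodType R).

(** Projectivity splits a finite free cover; the functionals are the coordinates of the
    splitting. *)
Lemma projective_dual_basis : finitely_generated P -> projective_module P ->
  exists n (x : 'I_n -> P) (f : 'I_n -> {linear P -> R^o}),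
    forall z, z = \sum_i f i z *: x i.
Proof.
move=> [n [x xE]] Pproj; have [c [cE _]] := free_map x.
have [|h hE] := Pproj _ _ c (idfun : {linear P -> P}).
  move=> y; have [a ->] := (xE y).1 I; exists [ffun i => a i].
  by rewrite cE; apply: eq_bigr => i _; rewrite ffunE.
have fL i : linear (fun z => h z i : R^o) by move=> a y z;
  rewrite linearP !ffunE.
by exists n, x, (fun i => mklin (fL i)) => z; rewrite -[LHS]hE cE.
Qed.

Lemma dual_basis_projective (J : finType) (x : J -> P)
    (f : J -> {linear P -> R^o}) :
    (forall z, z = \sum_i f i z *: x i) ->
  finitely_generated P /\ projective_module P.
Proof.
move=> xE; split.
  by apply: (@fg_submoduleP _ _ _ _ x) => z; split=> // _; exists (f^~ z).
move=> X Y p g ps; have /choice[y yE] i := ps (g (x i)).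
have hL : linear (fun z => \sum_i f i z *: y i).
  move=> a z w; rewrite scaler_sumr -big_split; apply: eq_bigr => i _ /=.
  by rewrite linearP scalerDl scalerA.
exists (mklin hL) => z /=; rewrite [z in RHS]xE !linear_sum.
by apply: eq_bigr => i _; rewrite !linearZ yE.
Qed.

End DualBasis.

(** Localizing this algebra at a prime yields the base ring R_p over which the localized algebras
    are compared. *)
Definition regular_alg (R : comPzRingType) : assocAlg R :=
  @AssocAlg R R idfun (@mulrC R).

(** * Coordinates on a tensor product of algebras *)

Section TensorMaps.
Variables (R : comPzRingType) (A B : assocAlg R).
Local Notation C := (tensor_alg A B).
Local Notation "a ** b" := (tens (a : alg_lmod A) (b : alg_lmod B) : C)
  (at level 40).

Fact tensor_inl_linear : linear (fun a : A => a ** 1).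
Proof. by move=> r x y; rewrite tensDl tensZl -tensor_alg_scale. Qed.
Definition tensor_inl : {linear A -> C} := mklin tensor_inl_linear.

Fact tensor_inr_linear : linear (fun b : B => 1 ** b).
Proof. by move=> r x y; rewrite tensDr tensZr -tensor_alg_scale. Qed.
Definition tensor_inr : {linear B -> C} := mklin tensor_inr_linear.

Fact tensor_inl1 : tensor_inl 1 = 1. Proof. by []. Qed.
Fact tensor_inr1 : tensor_inr 1 = 1. Proof. by []. Qed.
Fact tensor_inlM : {morph tensor_inl : a b / a * b}.
Proof. by move=> a b /=; rewrite tensor_alg_mul mulr1. Qed.
Fact tensor_inrM : {morph tensor_inr : a b / a * b}.
Proof. by move=> a b /=; rewrite tensor_alg_mul mulr1. Qed.

Section Coordinate.
Variable f : {linear B -> R^o}.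

Fact coord_bilinear : bilinear_map (fun (a : alg_lmod A) (b : alg_lmod B) =>
    (f b : R) *: a).
Proof.
split=> [a a' b|a b b'|k a b|k a b].
- exact: scalerDr.
- by rewrite linearD scalerDl.
- by rewrite !scalerA mulrC.
- by rewrite linearZ scalerA.
Qed.

(** The map id (x) f, with A (x) R identified with [A]. *)
Definition coord_fun : C -> A :=
  tens_lift (fun (a : alg_lmod A) (b : alg_lmod B) => (f b : R) *: a).

Lemma coord_funE (a : A) (b : B) : coord_fun (a ** b) = (f b : R) *: a.
Proof. exact: (tens_liftE coord_bilinear). Qed.

Fact coord_linear : linear coord_fun.
Proof.
move=> r x y; rewrite tensor_alg_scale.
exact: (tens_lift_is_linear coord_bilinear).
Qed.
Definition coord : {linear C -> A} := mklin coord_linear.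

End Coordinate.

Variables (n : nat) (b : 'I_n -> B) (f : 'I_n -> {linear B -> R^o}).
Hypothesis bE : forall z : alg_lmod B,
  z = \sum_i (f i z : R) *: (b i : alg_lmod B).

Lemma coord_sum (w : C) : w = \sum_i coord (f i) w ** b i.
Proof.
elim/tens_ind: w => [|u v hu hv|a z].
- by rewrite big1 // => i _; rewrite linear0 -(scale0r 0) tensZl scale0r.
- by rewrite {1}hu {1}hv -big_split; apply: eq_bigr => i _;
  rewrite linearD tensDl.
- rewrite {1}[z]bE (big_morph (fun z => a ** z) (id1 := 0) (op1 := +%R)).
  + by apply: eq_bigr => i _; rewrite [coord _ _]coord_funE tensZl tensZr.
  + by move=> x y; apply: tensDr.
  + by rewrite -(scale0r 0) tensZr scale0r.
Qed.

End TensorMaps.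

(** * Localized algebras over R_p *)

Section LocalRing.
Variables (R : comPzRingType) (p : spec R).

Section Fractions.
Variable C : assocAlg R.

Lemma locD (a b : C) (s t : denom p) :
  frac a s + frac b t = frac (dval t *: a + dval s *: b) (denomM s t).
Proof. exact: loc_addE. Qed.

Lemma locM (a b : C) (s t : denom p) :
  frac a s * frac b t = frac (a * b) (denomM s t).
Proof. exact: loc_mulE. Qed.

Lemma loc1 : (1 : localization C p) = frac 1 (denom1 p).
Proof. by []. Qed.

Lemma loc0 (s : denom p) : frac (0 : C) s = 0.
Proof. by apply: eq_frac; rewrite !scaler0. Qed.

Lemma fracD (a b : C) (s : denom p) : frac a s + frac b s = frac (a + b) s.
Proof. by rewrite locD; apply: eq_frac; rewrite -scalerDr scalerA. Qed.

Lemma frac_sum (I : finType) (a : I -> C) (s : denom p) :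
  \sum_i frac (a i) s = frac (\sum_i a i) s.
Proof.
by apply/esym/(big_morph (fun a : C => frac a s)) => [x y|];
  rewrite ?fracD ?loc0.
Qed.

Lemma denomM1 (s : denom p) (a : C) : frac a (denomM s (denom1 p)) = frac a s.
Proof. by apply: eq_frac; rewrite dvalM dval1 mulr1. Qed.

End Fractions.

Section LocMap.
Variables (C E : assocAlg R) (u : {linear C -> E}).

(** Computed on the chosen representative; [loc_mapE] shows that any other fraction gives the same
    value. *)
Definition loc_map (x : localization C p) : localization E p :=
  frac (u (num x)) (den x).

Lemma loc_mapE a s : loc_map (frac a s) = frac (u a) s.
Proof.
have /frac_eq[v vE] := frac_num_den (frac a s).
apply/frac_eq; exists v; have uZ r x : u (r *: x) = r *: u x by rewrite linearZ.
by rewrite -!uZ vE.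
Qed.

Lemma loc_mapD : {morph loc_map : x y / x + y}.
Proof.
elim/loc_ind=> a s; elim/loc_ind=> b t.
by rewrite locD !loc_mapE locD linearD !linearZ.
Qed.

Hypothesis u1 : u 1 = 1.
Hypothesis uM : {morph u : a b / a * b}.

Fact loc_map_zmod : zmod_morphism loc_map.
Proof.
move=> x y; apply: (addIr (loc_map y)).
by rewrite -loc_mapD !subrK.
Qed.
Fact loc_map_monoid : monoid_morphism loc_map.
Proof.
split=> [|]; first by rewrite loc1 loc_mapE u1.
by elim/loc_ind=> a s; elim/loc_ind=> b t; rewrite locM !loc_mapE locM uM.
Qed.

Definition loc_rmorph : {rmorphism localization C p -> localization E p} :=
  HB.pack loc_map (GRing.isZmodMorphism.Build _ _ loc_map loc_map_zmod)
    (GRing.isMonoidMorphism.Build _ _ loc_map loc_map_monoid).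

End LocMap.

Fact loc_regular_mulC : commutative (@GRing.mul
    (localization (regular_alg R) p)).
Proof.
elim/loc_ind=> a s; elim/loc_ind=> b t; rewrite !locM; apply: eq_frac.
by rewrite !dvalM [dval t * _]mulrC; congr (_ *: _); apply: (@mulrC R).
Qed.

Definition local_ring : comPzRingType :=
  HB.pack (localization (regular_alg R) p)
    (GRing.PzRing_hasCommutativeMul.Build (localization (regular_alg R) p)
      loc_regular_mulC).

Section Structure.
Variable C : assocAlg R.

Fact unit_linear : linear (fun r : regular_alg R => (r : R) *: (1 : C)).
Proof. by move=> r x y; rewrite scalerDl -scalerA. Qed.
Definition unit_map : {linear regular_alg R -> C} := mklin unit_linear.

Fact unit_map1 : unit_map 1 = 1. Proof. exact: scale1r. Qed.
Fact unit_mapM : {morph unit_map : a b / a * b}.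
Proof.
move=> a b /=; rewrite -alg_scaleAl mul1r scalerA; congr (_ *: _).
Qed.

Definition loc_unit : {rmorphism local_ring -> localization C p} :=
  loc_rmorph unit_map1 unit_mapM.

Lemma loc_unitE (r : R) s (a : C) t :
  loc_unit (frac (r : regular_alg R) s) * frac a t = frac (r *: a) (denomM s t).
Proof. by rewrite [loc_unit _]loc_mapE locM /= -alg_scaleAl mul1r. Qed.

Lemma loc_unitC (r : local_ring) (x : localization C p) :
  loc_unit r * x = x * loc_unit r.
Proof.
elim/loc_ind: x => a t; elim/loc_ind: r => r s; rewrite loc_unitE.
rewrite [loc_unit _]loc_mapE locM /= -alg_scaleAr mulr1; apply: eq_frac.
by rewrite !dvalM [dval s * _]mulrC.
Qed.

(** A denominator that kills 1 kills every fraction. Together with the converse below, this turns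
    nonvanishing into a condition on 1, which can be carried from the tensor product to its
    factors. *)
Lemma localization_nonzero (x : localization C p) :
  x <> 0 -> forall u, u \notin p -> u *: (1 : C) <> 0.
Proof.
elim/loc_ind: x => a s a0 u up u1; apply: a0.
rewrite -(loc0 C (denom1 p)); apply/frac_eq; exists (exist _ u up).
rewrite !scaler0 dval1 scale1r /dval /= -[a]mul1r alg_scaleAl u1.
exact: mul0r.
Qed.

Lemma nonzero_localization :
  (forall u, u \notin p -> u *: (1 : C) <> 0) ->
  exists x : localization C p, x <> 0.
Proof.
move=> u1; exists 1; rewrite loc1 -(loc0 C (denom1 p)) => /frac_eq[u].
by rewrite dval1 !scale1r scaler0; apply: u1 (svalP u).
Qed.

End Structure.

(** One-sided ideals of the localization contract to R-submodules of [C], which is a noetherian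
    R-module; scalars being central, both sides are treated alike. *)
Lemma localization_noetherian (C : assocAlg R) :
  left_noetherian R -> finitely_generated C ->
  left_noetherian (localization C p) /\ right_noetherian (localization C p).
Proof.
move=> Rn /(noetherian_fg Rn) Cn.
pose j (a : C) := frac a (denom1 p).
pose rho (r : R) := frac (r *: (1 : C)) (denom1 p).
have jD : {morph j : x y / x + y} by move=> x y; rewrite fracD.
have jl r a : j (r *: a) = rho r * j a.
  by rewrite locM -alg_scaleAl mul1r denomM1.
have jr r a : j (r *: a) = j a * rho r.
  by rewrite locM -alg_scaleAr mulr1 denomM1.
have sE (a : C) s : frac (1 : C) s * j a = frac a s.
  by rewrite locM mul1r denomM1.
have sE' (a : C) s : j a * frac (1 : C) s = frac a s.
  by rewrite locM mulr1; apply: eq_frac; rewrite dvalM dval1 mul1r.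
have jE (a : C) s : j a = frac (dval s *: (1 : C)) (denom1 p) * frac a s.
  rewrite locM -alg_scaleAl mul1r; apply: eq_frac.
  by rewrite dvalM dval1 mul1r scale1r.
have jE' (a : C) s : j a = frac a s * frac (dval s *: (1 : C)) (denom1 p).
  rewrite locM -alg_scaleAr mulr1; apply: eq_frac.
  by rewrite dvalM dval1 mulr1 scale1r.
split.
  apply: (@noetherian_fractions R (localization C p) C
    ((localization C p)^o) rho j) => //.
  elim/loc_ind=> a s; exists a, (frac 1 s), (frac (dval s *: (1 : C))
    (denom1 p)).
  by split; [exact: esym (sE _ _)|exact: jE].
apply: (@noetherian_fractions R (localization C p)^c C
  (((localization C p)^c)^o) rho j) => //.
elim/loc_ind=> a s; exists a, (frac 1 s), (frac (dval s *: (1 : C)) (denom1 p)).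
by split; [exact: esym (sE' _ _)|exact: jE'].
Qed.

(** * Localization of a tensor product *)

Section TensorLocalization.
Variables (A B : assocAlg R).
Local Notation C := (tensor_alg A B).
Local Notation "a ** b" := (tens (a : alg_lmod A) (b : alg_lmod B) : C)
  (at level 40).

Variables (n : nat) (b : 'I_n -> B) (f : 'I_n -> {linear B -> R^o}).
Hypothesis bE : forall z : alg_lmod B,
  z = \sum_i (f i z : R) *: (b i : alg_lmod B).

Let Ap := localization A p.
Let Bp := localization B p.
Let Cp := localization C p.

Definition inl_loc : {rmorphism Ap -> Cp} := loc_rmorph (tensor_inl1 A B)
    (@tensor_inlM R A B).
Definition inr_loc : {rmorphism Bp -> Cp} := loc_rmorph (tensor_inr1 A B)
    (@tensor_inrM R A B).

Lemma inlr_locE a s (z : B) t :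
  inl_loc (frac a s) * inr_loc (frac z t) = frac (a ** z) (denomM s t).
Proof.
rewrite [inl_loc _]loc_mapE [inr_loc _]loc_mapE locM /=.
by rewrite tensor_alg_mul mulr1 mul1r.
Qed.

Fact inlr_locC x y : inl_loc x * inr_loc y = inr_loc y * inl_loc x.
Proof.
elim/loc_ind: x => a s; elim/loc_ind: y => z t; rewrite inlr_locE.
rewrite [inl_loc _]loc_mapE [inr_loc _]loc_mapE locM /=.
rewrite tensor_alg_mul mulr1 mul1r.
by apply: eq_frac; rewrite !dvalM [dval t * _]mulrC.
Qed.

Fact inlr_loc_unit (r : local_ring) :
  inl_loc (loc_unit A r) = inr_loc (loc_unit B r).
Proof.
elim/loc_ind: r => r s; rewrite [loc_unit A _]loc_mapE [loc_unit B _]loc_mapE.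
by rewrite [LHS]loc_mapE [RHS]loc_mapE /= tensZl tensZr.
Qed.

Definition loc_coord i : Cp -> Ap := loc_map (coord A (f i)).

Definition loc_functional i (x : Bp^o) : local_ring^o :=
  @loc_map B (regular_alg R) (f i) x.

Definition loc_basis i : Bp := frac (b i) (denom1 p).

Fact loc_functional_linear i : rlinear idfun (loc_unit B) (loc_functional i).
Proof.
move=> r x y; rewrite [LHS]loc_mapD; congr (_ + _).
elim/loc_ind: x => z t; elim/loc_ind: r => r s.
rewrite [_ *: _]loc_unitE [LHS]loc_mapE [loc_functional i _]loc_mapE linearZ.
exact: esym (locM _ _ _ _).
Qed.

Fact loc_basisE (x : Bp) : x = \sum_i loc_unit B
    (loc_functional i x) * loc_basis i.
Proof.
elim/loc_ind: x => z t; rewrite {1}[z]bE -frac_sum; apply: eq_bigr => i _.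
by rewrite [loc_functional i _]loc_mapE loc_unitE denomM1.
Qed.

Fact loc_coordE i x y :
  loc_coord i (inl_loc x * inr_loc y) = x * loc_unit A (loc_functional i y).
Proof.
elim/loc_ind: x => a s; elim/loc_ind: y => z t; rewrite inlr_locE.
rewrite [LHS]loc_mapE [loc_functional i _]loc_mapE [loc_unit A _]loc_mapE locM
  /=.
by rewrite coord_funE -alg_scaleAr mulr1.
Qed.

Fact loc_coord_sum (w : Cp) :
  w = \sum_i inl_loc (loc_coord i w) * inr_loc (loc_basis i).
Proof.
elim/loc_ind: w => w t; rewrite {1}[w](coord_sum bE) -frac_sum;
  apply: eq_bigr => i _.
by rewrite [loc_coord i _]loc_mapE inlr_locE denomM1.
Qed.

(** The localized tensor product is the tensor product of the localizations over R_p, expressed by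
    the localized dual basis of [B]. *)
Definition loc_decomp : tensor_decomp Cp (loc_unit A) (loc_unit B) :=
  @TensorDecomp local_ring Ap Bp Cp (loc_unit A) (loc_unit B)
    (@loc_unitC A) (@loc_unitC B) inl_loc inr_loc inlr_locC inlr_loc_unit
    'I_n loc_basis loc_functional loc_functional_linear loc_basisE
    loc_coord (fun i => loc_mapD (coord A (f i))) loc_coordE loc_coord_sum.

End TensorLocalization.

End LocalRing.

(** * Projectivity and the Gorenstein property of the tensor product *)

Section TensorProjective.
Variables (R : comPzRingType) (A B : assocAlg R).

(** The tensors of basis vectors with the functionals f_i (x) g_j, the latter obtained as [f i]
    after [coord], form a dual basis. *)
Lemma tensor_projective :
    finitely_generated A -> projective_module A ->
    finitely_generated B -> projective_module B ->
  finitely_generated (tensor_alg A B) /\ projective_module (tensor_alg A B).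
Proof.
move=> Afg Ap Bfg Bp.
have [m [a [f aE]]] := projective_dual_basis Afg Ap.
have [n [b [g bE]]] := projective_dual_basis Bfg Bp.
have cL i j : linear (fun w : alg_lmod (tensor_alg A B) => f i (coord A
  (g j) w)).
  by move=> r u v; rewrite linearD linearZ linearD linearZ.
apply: (@dual_basis_projective R (alg_lmod (tensor_alg A B)) ('I_m * 'I_n)%type
  (fun ij => tens (a ij.1 : alg_lmod A) (b ij.2 : alg_lmod B))
  (fun ij => mklin (cL ij.1 ij.2))) => w.
rewrite -(pair_big xpredT xpredT (fun i j => (f i (coord A (g j) w) : R) *:
  (tens (a i : alg_lmod A) (b j : alg_lmod B) : alg_lmod (tensor_alg A B)))) /=.
rewrite exchange_big {1}[w](coord_sum bE); apply: eq_bigr => j _.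
rewrite {1}[coord A _ w]aE (big_morph
  (fun z : A => tens (z : alg_lmod A) (b j : alg_lmod B) : tensor_alg A B)
  (id1 := 0) (op1 := +%R)).
- by apply: eq_bigr => i _; rewrite tensZl -tensor_alg_scale.
- by move=> x y; apply: tensDl.
- by rewrite -(scale0r 0) tensZl scale0r.
Qed.

End TensorProjective.

Theorem corollary6p10 (R : comPzRingType) (noethR : left_noetherian R)
    (A B : assocAlg R) :
  gorenstein_algebra A -> gorenstein_algebra B ->
  gorenstein_algebra (tensor_alg A B).
Proof.
move=> [Afg Aproj Ag] [Bfg Bproj Bg].
have [Cfg Cproj] := tensor_projective Afg Aproj Bfg Bproj.
split=> // p [x x0]; have Cp1 := localization_nonzero x0.
have [|_ _ Al Ar] := Ag p.
  (* If [u] kills 1 in [A], it kills 1 (x) 1, which is excluded by [Cp1]; the same argument serves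
     for [B]. *)
  apply: nonzero_localization => u up u1; apply: (Cp1 u up).
  rewrite tensor_alg_scale -[1 in LHS](tensor_inl1 A B) -tensor_alg_scale.
  by rewrite -linearZ u1 linear0.
have [|_ _ Bl Br] := Bg p.
  apply: nonzero_localization => u up u1; apply: (Cp1 u up).
  rewrite tensor_alg_scale -[1 in LHS](tensor_inr1 A B) -tensor_alg_scale.
  by rewrite -linearZ u1 linear0.
have [Cln Crn] := localization_noetherian p noethR Cfg.
have [n [b [f bE]]] := projective_dual_basis Bfg Bproj.
pose D := loc_decomp p A bE.
split=> //; first exact: tensor_injdim D Al Bl.
exact: tensor_injdim (op_decomp D) Ar Br.
Qed.
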